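(* Let $\varphi:[0,+\infty)\to(0,+\infty)$ be a function such that $t\mapsto t\varphi(t)$ is monotone decreasing on $[1,+\infty)$ and $\int_{1}^{+\infty}\varphi(t)\,dt=+\infty$. Then for every flat torus $X$ with $r$ punctures $p_1,\dots,p_r$ and for Lebesgue-almost every $\theta\in[0,2\pi)$ there are at least $2r-1$ different ordered pairs of punctures $(p_j,p_i)$ (with $p_j=p_i$ allowed) such that the corresponding set $\mathrm{Hol}^{(p_j,p_i)}(X_\theta)$ contains infinitely many elements $v$ satisfying $|\mathrm{Re}(v)|<\varphi(|v|)$.
   Context: A flat torus $X$ with $r\ge1$ punctures is a quotient $\mathbb{C}/\Lambda$ of $\mathbb{C}$ by a lattice $\Lambda$ together with a set $\Sigma=\{p_1,\dots,p_r\}\subset X$ of $r$ distinct points. A saddle connection is a straight (geodesic) segment $\gamma$ in $X$ of positive length whose endpoints lie in $\Sigma$ and whose interior contains no point of $\Sigma$; its holonomy is $\mathrm{Hol}(\gamma)=\int_\gamma dz\in\mathbb{C}$. For $p_j,p_i\in\Sigma$, $\mathrm{Hol}^{(p_j,p_i)}(X)$ is the set of holonomies of all saddle connections of $X$ which start at $p_j$ and end at $p_i$. For $\theta\in\mathbb{R}$, $X_\theta$ is the punctured flat torus obtained from $X$ by rotation by $R_\theta=\begin{pmatrix}\cos\theta&-\sin\theta\\ \sin\theta&\cos\theta\end{pmatrix}$, so that $\mathrm{Hol}^{(p_j,p_i)}(X_\theta)=R_\theta\,\mathrm{Hol}^{(p_j,p_i)}(X)$. *)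

(* Defs.v *)
From HB Require Import structures.
From mathcomp Require Import all_boot all_order all_algebra.
From mathcomp Require Import complex.
From mathcomp Require Import all_classical all_reals all_analysis.

Set Implicit Arguments.
Unset Strict Implicit.
Unset Printing Implicit Defensive.

Import Order.TTheory GRing.Theory Num.Theory.
Import numFieldNormedType.Exports.

Local Open Scope classical_set_scope.
Local Open Scope complex_scope.
Local Open Scope ring_scope.

Definition is_lattice (R : realType) (L : set R[i]) : Prop :=
  exists w1 w2 : R[i],
    (forall a b : R, a%:C * w1 + b%:C * w2 = 0 -> a = 0 /\ b = 0) /\
    L = [set z | exists m n : int, z = w1 *~ m + w2 *~ n].

Definition lattice_coset (R : realType) (L : set R[i]) (z : R[i]) : set R[i] :=
  [set z + l | l in L].

Definition torus (R : realType) (L : set R[i]) : set (set R[i]) :=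
  range (lattice_coset L).

Record punctured_torus (R : realType) (r : nat) := PuncturedTorus {
  lattice : set R[i];
  latticeP : is_lattice lattice;
  puncture : 'I_r -> set R[i];
  punctureP : forall i, torus lattice (puncture i);
  puncture_inj : injective puncture }.

Definition torus_proj (R : realType) (r : nat) (X : punctured_torus R r)
  (z : R[i]) : set R[i] := lattice_coset (lattice X) z.

(* A geodesic segment of X is the projection of a straight segment of C; it is
   given here by a lift c, parametrized affinely, of which only the restriction
   to [0, 1] matters. *)
Definition is_saddle_connection (R : realType) (r : nat)
    (X : punctured_torus R r) (c : R -> R[i]) : Prop :=
  [/\ exists z v : R[i], v != 0 /\ forall t : R, c t = z + t%:C * v,
      range (puncture X) (torus_proj X (c 0)),
      range (puncture X) (torus_proj X (c 1)) &
      forall t : R, 0 < t < 1 -> ~ range (puncture X) (torus_proj X (c t))].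

(* The integral of dz along the path c : [0, 1] -> C. It is the same for every
   lift of a path of the torus, dz being invariant under translations. *)
Definition hol (R : realType) (c : R -> R[i]) : R[i] :=
  (\int[lebesgue_measure]_(t in `[0, 1])
     derive1 (fun s : R => complex.Re (c s)) t)
  +i*
  (\int[lebesgue_measure]_(t in `[0, 1])
     derive1 (fun s : R => complex.Im (c s)) t).

Definition Hol (R : realType) (r : nat) (X : punctured_torus R r)
    (j i : 'I_r) : set R[i] :=
  [set v | exists c : R -> R[i],
     [/\ is_saddle_connection X c, torus_proj X (c 0) = puncture X j,
         torus_proj X (c 1) = puncture X i & v = hol c]].

Definition rotC (R : realType) (theta : R) (z : R[i]) : R[i] :=
  (cos theta * complex.Re z - sin theta * complex.Im z) +i*
  (sin theta * complex.Re z + cos theta * complex.Im z).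

Lemma rotCE (R : realType) (theta : R) (z : R[i]) :
  rotC theta z = (cos theta +i* sin theta) * z.
Proof. by case: z => x y; congr Complex; rewrite addrC. Qed.

Lemma cis_neq0 (R : realType) (theta : R) :
  cos theta +i* sin theta != 0 :> R[i].
Proof.
apply/eqP => -[c0 s0].
have := cos2Dsin2 theta; rewrite c0 s0 expr0n addr0 => /esym/eqP.
by rewrite oner_eq0.
Qed.

Lemma rotC_inj (R : realType) (theta : R) : injective (@rotC R theta).
Proof. by move=> x y; rewrite !rotCE => /(mulfI (cis_neq0 theta)). Qed.

Lemma is_lattice_rotC (R : realType) (theta : R) (L : set R[i]) :
  is_lattice L -> is_lattice (rotC theta @` L).
Proof.
move=> [w1 [w2 [indep ->]]]; exists (rotC theta w1), (rotC theta w2); split.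
  move=> a b; rewrite !rotCE !(mulrCA _%:C) -mulrDr => /eqP.
  by rewrite mulf_eq0 (negPf (cis_neq0 theta)) => /eqP/indep.
apply/seteqP; split=> [_ [_ [m [n ->]] <-]|_ [m [n ->]]].
  by exists m, n; rewrite !rotCE mulrDr !mulrzAr.
exists (w1 *~ m + w2 *~ n); first by exists m, n.
by rewrite !rotCE mulrDr !mulrzAr.
Qed.

Lemma torus_rotC (R : realType) (theta : R) (L p : set R[i]) :
  torus L p -> torus (rotC theta @` L) (rotC theta @` p).
Proof.
move=> [z _ <-]; exists (rotC theta z) => //.
apply/seteqP; split=> [_ [_ [l Ll <-] <-]|_ [_ [l Ll <-] <-]].
  by exists (z + l); [exists l | rewrite !rotCE mulrDr].
by exists (rotC theta l); [exists l | rewrite !rotCE mulrDr].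
Qed.

Lemma image_rotC_inj (R : realType) (theta : R) :
  injective (fun A : set R[i] => rotC theta @` A).
Proof.
have sub A B : rotC theta @` A = rotC theta @` B -> A `<=` B.
  move=> AB z Az.
  have : (rotC theta @` B) (rotC theta z) by rewrite -AB; exists z.
  by move=> [w Bw /rotC_inj <-].
by move=> A B AB; apply/seteqP; split; apply: sub.
Qed.

Lemma puncture_rotC_inj (R : realType) (r : nat) (theta : R)
    (X : punctured_torus R r) :
  injective (fun i => rotC theta @` puncture X i).
Proof. by move=> i j /image_rotC_inj /puncture_inj. Qed.

Definition rotate_torus (R : realType) (r : nat) (theta : R)
    (X : punctured_torus R r) : punctured_torus R r :=
  PuncturedTorus (is_lattice_rotC theta (latticeP X))
    (fun i => torus_rotC theta (punctureP X i))
    (@puncture_rotC_inj R r theta X).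

(* Main.v *)
Require Import Defs.
From mathcomp Require Import all_boot all_order all_algebra.
From mathcomp Require Import complex.
From mathcomp Require Import all_classical all_reals all_analysis.
From mathcomp Require Import measurable_realfun.
From mathcomp Require Import ring lra zify.

(** The combinatorial half of the argument shows that, for almost every angle,
    each puncture starts good saddle connections (those whose rotated holonomy
    satisfies the inequality) towards some puncture in infinite number, and
    towards two different punctures as soon as [r >= 2]. This gives [2 * r]
    pairs when [r >= 2] and one pair when [r = 1].

    Its input is [rotated_khinchin]: given a lattice and a translate of it,
    almost every angle admits arbitrarily long good vectors in that translate.
    A countable family of translates is used: the differences of two punctures,
    and the cosets [w_i + N * L], where [w_1], [w_2] is a basis of the lattice [L].
    A long good vector from a puncture [l] to a puncture is cut at the first
    puncture it meets. As [t * phi t] decreases, the initial piece is again good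
    ([good_shorten]), and it is none of finitely many given vectors because the
    angle avoids the countably many directions making a holonomy vertical
    ([good_avoid]). So if only the pairs from [l] to punctures of [D] carry
    infinitely many good saddle connections, then every long good vector issued
    from [l] first hits a puncture of [D] ([first_good_hit]). With [D] empty this
    is absurd ([exists_linked]). With [D = {l}] the segment runs along a closed
    geodesic meeting no puncture but [l], and a vector leading to some [q <> l] is a
    contradiction ([linked_not_only_loops]). With [D = {m}] and [m <> l], put
    [d = z m - z l]. Every long good [v] in [L] has a multiple in [d + L], so the
    area of [v] and [d] is an integer multiple of the covolume. Two independent
    such [v] give [N * d] in [L] for some [N <> 0], and then good vectors in
    [w_i + N * L] show that the areas of [w_1] and [w_2] with [d] are integral too.
    Hence [d] is in [L], which is absurd ([linked_not_only]).

    The analytic half proves [rotated_khinchin] through slopes: in a basis of the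
    lattice, the real part of a rotated vector of coordinates [m + s1], [n + s2] is,
    up to a bounded factor, [(n + s2) * x - (m + s1)], where the slope [x] is an
    affine function of a tangent of the angle. The inverse map is Lipschitz on each
    branch, so null sets of slopes give null sets of angles
    ([negligible_slope_angle]). For slopes, it suffices that the set missed by all
    the approximations beyond a given size fills at most half of each interval
    ([null_of_half_density]). Cut an interval into [16 ^ n] cells and put
    [T = tau * 4 ^ n]. By Dirichlet's theorem and Bezout's identity, a point which
    is not abnormally close to a rational of denominator at most [e * T] is within
    a quarter of a cell of some [(m + s1) / (n + s2)] with [n + s2] of size [T]
    ([shifted_lattice_point]), and at most one cell in eight has an abnormal
    centre ([few_small_vectors]). Thus most cells of level [n] contain an interval,
    avoided by the missed set, of relative length comparable to [T * phi T]. The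
    sum over [n] of these lengths diverges with the integral of [phi]
    ([geometric_series_diverges]), while intervals of different levels overlap
    little, so they cannot all be avoided by more than half of the interval
    ([ubiquity]). *)

Set Implicit Arguments.
Unset Strict Implicit.
Unset Printing Implicit Defensive.

Import Order.TTheory GRing.Theory Num.Theory.
Import numFieldNormedType.Exports.

Local Open Scope classical_set_scope.
Local Open Scope ring_scope.

(** * Null sets of the line *)

(** The value of Lebesgue measure on an arbitrary set is that of the outer
    measure built from half-open intervals. *)
Lemma lebesgue_itv_cover (R : realType) (E : set R) (e : R) :
  0 < e -> (lebesgue_measure E < +oo)%E ->
  exists a b : nat -> R, [/\ forall k, a k <= b k,
    E `<=` \bigcup_k `]a k, b k]%classic &
    (\sum_(0 <= k <oo) (b k - a k)%:E <= lebesgue_measure E + e%:E)%E].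
Proof.
move=> e0 Efin.
have : lebesgue_measure E \is a fin_num by rewrite ge0_fin_numE.
move=> /lb_ereal_inf_adherent-/(_ _ e0)[_/= [F] [mF EF] <- Fe].
have /choice[ab abP] : forall k, exists ab : R * R,
    ab.1 <= ab.2 /\ F k = `]ab.1, ab.2]%classic.
  move=> k; have /ocitvP[->|[ab ab12 ->]] := mF k; last first.
    by exists ab; split => //; exact: ltW.
  by exists (0, 0); split => //=; rewrite set_itvoc0.
exists (fun k => (ab k).1), (fun k => (ab k).2); split.
- by move=> k; have [] := abP k.
- move=> x /EF[k _ Fkx]; exists k => //.
  by have [_ <-] := abP k.
- apply: le_trans (ltW Fe).
  apply: lee_nneseries => [k _ _|k _].
    by rewrite lee_fin subr_ge0; have [] := abP k.
  have [ab12 ->] := abP k; rewrite wlength_itv/= lte_fin.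
  by case: ltP => // ba; rewrite lee_fin subr_le0.
Qed.

(** A cheap substitute for the Lebesgue density theorem: cover [E] by intervals
    of total length [mu E + e]; each of them has at most half of its length in [E],
    so that [mu E <= (mu E + e) / 2]. *)
Lemma null_of_half_density (R : realType) (E : set R) :
  measurable E ->
  (forall a b : R, a < b -> (lebesgue_measure (E `&` `]a, b]) <= ((b - a) / 2)%:E)%E) ->
  lebesgue_measure E = 0%E.
Proof.
move=> mE half.
have bnd (n : nat) : lebesgue_measure (E `&` `](- n%:R), n%:R]) = 0%E.
  set F := E `&` _.
  have mF : measurable F by apply: measurableI => //; exact: measurable_itv.
  have Ffin : (lebesgue_measure F < +oo)%E.
    apply: (@le_lt_trans _ _ (lebesgue_measure (`](- n%:R), n%:R]%classic : set R))).
      by apply: le_measure; rewrite ?inE//; exact: subIsetr.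
    by rewrite lebesgue_measure_itv/=; case: ifP => _; rewrite ?ltry// -EFinD ltry.
  have Fn : lebesgue_measure F \is a fin_num by rewrite ge0_fin_numE.
  suff le_e (e : R) : 0 < e -> (lebesgue_measure F <= e%:E)%E.
    apply/eqP; rewrite eq_le measure_ge0 andbT; apply/lee_addgt0Pr => e /le_e.
    by rewrite add0e.
  move=> e0; have [a [b [ab Fab Sab]]] := lebesgue_itv_cover e0 Ffin.
  have Fle : (lebesgue_measure F <= \sum_(0 <= k <oo) ((b k - a k) / 2)%:E)%E.
    apply: (@le_trans _ _ (\sum_(0 <= k <oo) lebesgue_measure (F `&` `]a k, b k]))%E).
      have FE : F `<=` \bigcup_k (F `&` `]a k, b k]).
        by move=> x Fx; have [k _ ?] := Fab _ Fx; exists k.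
      apply: measure_sigma_subadditive => // k.
      by apply: measurableI => //; exact: measurable_itv.
    apply: lee_nneseries => // k _.
    move: (ab k); rewrite le_eqVlt => /orP[/eqP->|abk].
      by rewrite set_itvoc0 setI0 measure0 subrr mul0r.
    apply: le_trans (half _ _ abk); apply: le_measure; rewrite ?inE.
    - by apply: measurableI => //; exact: measurable_itv.
    - by apply: measurableI => //; exact: measurable_itv.
    - by apply: setSI; exact: subIsetl.
  have S2 : (\sum_(0 <= k <oo) ((b k - a k) / 2)%:E = (2^-1)%:E * \sum_(0 <= k <oo) (b k - a k)%:E)%E.
    rewrite -nneseriesZl; last by move=> k _; rewrite lee_fin subr_ge0.
    by apply: eq_eseriesr => k _; rewrite -EFinM mulrC.
  have : (lebesgue_measure F <= (2^-1)%:E * (lebesgue_measure F + e%:E))%E.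
    by apply: (le_trans Fle); rewrite S2 lee_pmul2l ?lte_fin ?invr_gt0.
  move: Fn => /fineK <-; rewrite -EFinD -EFinM !lee_fin; lra.
have mI (n : nat) : measurable (E `&` `](- n%:R), n%:R]) .
  by apply: measurableI => //; exact: measurable_itv.
have EU : E = \bigcup_n (E `&` `](- n%:R), n%:R]).
  apply/seteqP; split=> [x Ex|x [n _ []//]].
  have xb := archi_boundP (normr_ge0 x).
  exists (Num.bound `|x|) => //; split => //=; rewrite in_itv/=.
  by move: xb; rewrite ltr_norml => /andP[-> /ltW].
apply/negligibleP => //; rewrite EU; apply: negligible_bigcup => n.
exact: (negligibleP lebesgue_measure (mI n)).2 (bnd n).
Qed.

(** A cover of [N] by intervals of total length [d] is sent into intervals of
    total length [2 * k * d]. *)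
Lemma negligible_lipschitz_image (R : realType) (g : R -> R) (k : R) (N : set R) :
  (forall x y, `|g x - g y| <= k * `|x - y|) ->
  lebesgue_measure.-negligible N -> lebesgue_measure.-negligible (g @` N).
Proof.
move=> gk /negligible_outer_measure N0; apply/negligible_outer_measure.
have {}N0 : lebesgue_measure N = 0%E := N0.
have k0 : 0 <= k.
  by have := gk 1 0; rewrite subr0 normr1 mulr1; exact: le_trans.
have aux (e : R) : 0 < e -> 2 * k * (e / (2 * (k + 1))) <= e.
  move=> e0; have k1 : k + 1 != 0 by rewrite gt_eqF// ltr_wpDl.
  have -> : 2 * k * (e / (2 * (k + 1))) = e * (k / (k + 1)) by field.
  by rewrite ler_piMr ?(ltW e0)// ler_pdivrMr ?ltr_wpDl//; lra.
suff small (e : R) : 0 < e -> (lebesgue_measure (g @` N) <= e%:E)%E.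
  apply/eqP; rewrite eq_le outer_measure_ge0 andbT.
  by apply/lee_addgt0Pr => e /small; rewrite add0e.
move=> e0.
have d0 : 0 < e / (2 * (k + 1)) by rewrite divr_gt0// mulr_gt0// ltr_wpDl.
have [|a [b [ab Nab Sab]]] := @lebesgue_itv_cover R N _ d0; first by rewrite N0.
rewrite N0 add0e in Sab.
pose J n : set R := `[g (b n) - k * (b n - a n), g (b n) + k * (b n - a n)]%classic.
have gJ : g @` N `<=` \bigcup_n J n.
  move=> _ [x /Nab[n _ /= +] <-]; rewrite in_itv/= => /andP[ax xb].
  exists n => //; rewrite /J/= in_itv/= -ler_distl (le_trans (gk _ _))//.
  rewrite ler_wpM2l// distrC ger0_norm; lra.
have := @outer_measure_sigma_subadditive _ _ (wlength idfun)^*%mu J.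
move=> /(le_trans (le_outer_measure (wlength idfun)^*%mu _ _ gJ)) h.
apply: (le_trans h).
pose S : \bar R := (\sum_(0 <= n <oo) ((2 * k)%:E * (b n - a n)%:E))%E.
apply: (@le_trans _ _ S).
  apply: lee_nneseries => [n _ _|n _]; first exact: outer_measure_ge0.
  have kb : 0 <= k * (b n - a n) by rewrite mulr_ge0// subr_ge0.
  rewrite -[leLHS]/(lebesgue_measure (J n)) /J lebesgue_measure_itv/=.
  by case: ifP => _; rewrite -?EFinM ?lee_fin; lra.
rewrite /S nneseriesZl; last by move=> n _; rewrite lee_fin subr_ge0.
apply: (@le_trans _ _ ((2 * k)%:E * (e / (2 * (k + 1)))%:E)%E).
  by rewrite lee_wpmul2l// lee_fin mulr_ge0.
rewrite -EFinM lee_fin; exact: aux.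
Qed.

(** * Ubiquitous intervals leave at most half of an interval *)

(** Each new set contributes at least what it does not share with the earlier
    ones. *)
Lemma bonferroni_le d (T : measurableType d) (R : realType)
    (mu : {measure set T -> \bar R}) (I : set T) (V : nat -> set T)
    (L : R) (w : nat -> R) (o : nat -> nat -> R) (N : nat) :
  measurable I -> (mu I <= L%:E)%E ->
  (forall n, measurable (V n)) -> (forall n, V n `<=` I) ->
  (forall n, ((w n)%:E <= mu (V n))%E) ->
  (forall m n, (m < n)%N -> (mu (V m `&` V n) <= (o m n)%:E)%E) ->
  \sum_(n < N) (w n - \sum_(m < n) o m n) <= L.
Proof.
move=> mI muI mV VI wV oV.
have finV n : (mu (V n) < +oo)%E.
  apply: (@le_lt_trans _ _ (mu I)); first by apply: le_measure; rewrite ?inE//.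
  by apply: le_lt_trans muI _; rewrite ltry.
have mU n : measurable (\big[setU/set0]_(k < n) V k).
  by apply: bigsetU_measurable.
rewrite -lee_fin -sumEFin; apply: le_trans muI.
apply: (@le_trans _ _ (\sum_(n < N) mu (seqDU V n))%E); last first.
  rewrite -(measure_bigsetU mu (seqDU_measurable mV) (@trivIset_seqDU _ V)).
  rewrite -bigsetU_seqDU; apply: le_measure; rewrite ?inE//.
  by rewrite -bigcup_mkord; apply: bigcup_sub => k _; exact: VI.
apply: lee_sum => n _; rewrite /seqDU measureD ?finV//.
rewrite EFinB; apply: leeB; first exact: wV.
rewrite -sumEFin.
apply: (@le_trans _ _ (\sum_(m < n) mu (V m `&` V n))%E).
  apply: (@content_subadditive _ _ _ mu _ (fun m => V m `&` V n)).
  - by move=> k _; exact: measurableI.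
  - exact: measurableI.
  - move=> x [Vnx Vx]; rewrite -bigcup_mkord in Vx; rewrite -(bigcup_mkord n (fun m => V m `&` V n)).
    by case: Vx => k kn Vk; exists k.
by apply: lee_sum => m _; exact: oV.
Qed.

(** If [E] filled more than half of the interval, it would meet at least [3 / 8] of
    the cells of level [n], among those that contain an interval avoiding [E] of
    relative length [h n]. These intervals would have total length at least
    [3 / 8 * h n * L].
    Intervals of levels [m < n] hardly overlap, since at level [n] only the two
    cells that contain the ends of an interval of level [m] can both meet [E] and
    that interval. A divergent sum of the [h n] then exceeds the length [L]. *)
Section ubiquity.
Variables (R : realType) (E : set R) (a L : R).
Variables (u v : nat -> nat -> R) (h : nat -> R) (G : nat -> nat -> bool) (n0 : nat).
Hypotheses (mE : measurable E) (L0 : 0 < L) (h0 : forall n, 0 <= h n).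

Let l n : R := L / 16 ^+ n.
Let cell n i : set R := `]a + i%:R * l n, a + i.+1%:R * l n]%classic.
Local Notation mu := (@lebesgue_measure R).

Hypothesis uvP : forall n i, G n i ->
  [/\ a + i%:R * l n <= u n i, v n i <= a + i.+1%:R * l n & v n i - u n i = h n * l n].
Hypothesis uvE : forall n i, G n i -> E `&` `]u n i, v n i[ = set0.
Hypothesis Gbig : forall n, (n0 <= n)%N -> 
  7 / 8 * 16 ^+ n <= \sum_(i < 16 ^ n) (G n i)%:R :> R.
Hypothesis hdiv : forall B : R, exists N : nat, B < \sum_(n < N) h (n0 + n)%N.

Let l_gt0 n : 0 < l n. Proof. by rewrite /l divr_gt0// exprn_gt0. Qed.

Let cellP n i x : cell n i x -> i%:R < (x - a) / l n <= i.+1%:R.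
Proof.
rewrite /cell/= in_itv/= => /andP[x1 x2].
by rewrite ltr_pdivlMr// ler_pdivrMr//; apply/andP; split; lra.
Qed.

Let cell_inj n i j x : cell n i x -> cell n j x -> i = j.
Proof.
move=> /cellP/andP[i1 i2] /cellP/andP[j1 j2].
have := lt_le_trans i1 j2; have := lt_le_trans j1 i2; rewrite !ltr_nat.
by rewrite !ltnS => ij ji; apply/eqP; rewrite eqn_leq ij ji.
Qed.

Let cell_sub n i : (i < 16 ^ n)%N -> cell n i `<=` `]a, a + L].
Proof.
move=> i16 x; rewrite /cell/= !in_itv/= => /andP[x1 x2].
have l0 := l_gt0 n.
have -> : L = 16 ^+ n * l n by rewrite /l mulrC divfK// expf_neq0.
apply/andP; split.
  by apply: le_lt_trans x1; rewrite lerDl mulr_ge0// ltW.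
apply: (le_trans x2); rewrite lerD2l ler_wpM2r ?(ltW l0)//.
by rewrite -natrX ler_nat.
Qed.

Let cell_cover n x : x \in `]a, a + L] -> exists2 i, (i < 16 ^ n)%N & cell n i x.
Proof.
rewrite in_itv/= => /andP[ax xa].
have l0 := l_gt0 n.
have y0 : 0 < (x - a) / l n by rewrite divr_gt0// subr_gt0.
have LE : L = 16 ^+ n * l n by rewrite /l mulrC divfK// expf_neq0.
have y1 : (x - a) / l n <= 16 ^+ n.
  by rewrite ler_pdivrMr// -LE; lra.
have [c cP] : exists c : nat, c%:R < (x - a) / l n <= c.+1%:R.
  have /archi_boundP : 0 <= (x - a) / l n by exact: ltW.
  elim: (Num.bound _) => [|k IH] yk; first by move: (lt_trans y0 yk); rewrite ltxx.
  have [|kl] := leP ((x - a) / l n) k%:R; last by exists k; rewrite kl ltW.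
  rewrite le_eqVlt => /orP[/eqP yk'|/IH//].
  move: (y0); rewrite yk'; case: k {IH yk yk'} => [|k _]; first by rewrite ltxx.
  by exists k; rewrite ltr_nat ltnSn lexx.
move: cP => /andP[c1 c2]; exists c.
  by have := lt_le_trans c1 y1; rewrite -natrX ltr_nat.
move: c1 c2; rewrite /cell/= in_itv/= ltr_pdivlMr// ler_pdivrMr// => c1 c2.
by apply/andP; split; lra.
Qed.

Let M n i := G n i && `[< E `&` cell n i !=set0 >].
Let J n i : set R := if M n i then `]u n i, v n i[%classic else set0.
Let V n : set R := \big[setU/set0]_(i < 16 ^ n) J n i.

Let mJ n i : measurable (J n i).
Proof. by rewrite /J; case: ifP => _; [exact: measurable_itv|exact: measurable0]. Qed.

Let mV n : measurable (V n).
Proof. exact: bigsetU_measurable. Qed.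

Let J_cell n i : J n i `<=` cell n i.
Proof.
rewrite /J; case: ifP => [/andP[Gni _]|_] x //; have [u1 v1 _] := uvP Gni.
rewrite /cell /= !in_itv/= => /andP[ux xv].
by rewrite (le_lt_trans u1 ux) (le_trans (ltW xv) v1).
Qed.

Let J_measure n i : mu (J n i) = ((M n i)%:R * (h n * l n))%:E.
Proof.
rewrite /J; case: ifPn => [Mni|_]; last by rewrite measure0 mul0r.
have /andP[Gni _] := Mni; have [_ _ uv] := uvP Gni.
rewrite mul1r lebesgue_measure_itv/= lte_fin -uv.
case: ltP => //; rewrite -subr_le0 uv => vu.
have := mulr_ge0 (h0 n) (ltW (l_gt0 n)) => uv0.
by congr (_%:E); apply/eqP; rewrite eq_le uv0 vu.
Qed.

Let VJ n x : V n x -> exists2 i, (i < 16 ^ n)%N & J n i x.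
Proof. by rewrite /V -bigcup_mkord => -[i i16 Jx]; exists i. Qed.

Let V_measure n : mu (V n) = ((\sum_(i < 16 ^ n) (M n i)%:R) * (h n * l n))%:E.
Proof.
rewrite /V measure_bigsetU; [|exact: mJ|]; last first.
  move=> i j _ _ [x [/J_cell xi /J_cell xj]]; exact: cell_inj xi xj.
rewrite mulr_suml -sumEFin; apply: eq_bigr => i _; exact: J_measure.
Qed.

(* A cell that meets both E, hence the complement of J m i, and J m i contains an
   end of J m i. *)
Let J_overlap m i n : (mu (J m i `&` V n) <= (2 * (h n * l n))%:E)%E.
Proof.
have hl0 : 0 <= h n * l n by rewrite mulr_ge0// ltW.
have [Mmi|/negbTE Mmi] := boolP (M m i); last first.
  by rewrite /J Mmi set0I measure0 lee_fin mulr_ge0.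
have JE : J m i = `]u m i, v m i[%classic by rewrite /J Mmi.
have [Gmi _] := andP Mmi.
have idx y : exists K : set R, [/\ measurable K, (mu K <= (h n * l n)%:E)%E &
    forall j, cell n j y -> J n j `<=` K].
  have [[j cj]|nj] := pselect (exists j, cell n j y); last first.
    exists set0; split => //; first by rewrite measure0 lee_fin.
    by move=> j cj; exfalso; apply: nj; exists j.
  exists (J n j); split => //.
    by rewrite J_measure lee_fin ler_piMl//; case: (M n j).
  by move=> k ck; rewrite (cell_inj cj ck).
have [K1 [mK1 muK1 K1P]] := idx (u m i).
have [K2 [mK2 muK2 K2P]] := idx (v m i).
apply: (@le_trans _ _ (mu (K1 `|` K2))).
  have sub : J m i `&` V n `<=` K1 `|` K2; last first.
    apply: le_measure; rewrite ?inE.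
    - exact: (measurableI _ _ (mJ m i) (mV n)).
    - exact: (measurableU _ _ mK1 mK2).
    - exact: sub.
  move=> x [Jx /VJ[j j16 Jnx]].
  have [Mnj|/negbTE Mnj] := boolP (M n j); last by move: Jnx; rewrite /J Mnj.
  have /andP[_ /asboolP[y [Ey cy]]] := Mnj.
  have cx := J_cell Jnx.
  have yJ : ~ (u m i < y < v m i).
    by move=> yuv; have : (E `&` `]u m i, v m i[) y by []; rewrite uvE.
  move: Jx cx cy; rewrite JE /cell/= !in_itv/= => /andP[ux xv] /andP[x1 x2] /andP[y1 y2].
  have [yu|uy] := leP y (u m i); [left; apply: K1P Jnx|right; apply: K2P Jnx].
    by rewrite /cell/= in_itv/= (lt_le_trans y1 yu) (le_trans (ltW ux) x2).
  have vy : v m i <= y by rewrite leNgt; apply/negP => yv; apply: yJ; rewrite uy yv.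
  by rewrite /cell/= in_itv/= (lt_trans x1 xv) (le_trans vy y2).
apply: (@le_trans _ _ (mu K1 + mu K2)%E); first by apply: measureU2; [exact: mK1|exact: mK2].
have -> : 2 * (h n * l n) = h n * l n + h n * l n by ring.
by rewrite EFinD leeD.
Qed.

Let V_overlap m n : (mu (V m `&` V n) <= (2 * 16 ^+ m * (h n * l n))%:E)%E.
Proof.
have hl0 : 0 <= h n * l n by rewrite mulr_ge0// ltW.
apply: (@le_trans _ _ (\sum_(i < 16 ^ m) mu (J m i `&` V n))%E).
  apply: (@content_subadditive _ _ _ mu _ (fun i => J m i `&` V n)).
  - by move=> k _; exact: (measurableI _ _ (mJ m k) (mV n)).
  - exact: (measurableI _ _ (mV m) (mV n)).
  - by move=> x [/VJ[i i16 Jx] Vx]; rewrite -(bigcup_mkord _ (fun i => J m i `&` V n)); exists i.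
apply: (@le_trans _ _ (\sum_(i < 16 ^ m) (2 * (h n * l n))%:E)%E).
  by apply: lee_sum => i _; exact: J_overlap.
rewrite sumEFin lee_fin sumr_const card_ord -[leLHS]mulr_natl natrX.
by rewrite mulrCA mulrA.
Qed.

Lemma ubiquity : (mu (E `&` `]a, (a + L)%R]) <= (L / 2)%:E)%E.
Proof.
rewrite leNgt; apply/negP => Ebig.
have mI : measurable (`]a, a + L] : set R) by exact: measurable_itv.
have muI : mu `]a, a + L] = L%:E.
  rewrite lebesgue_measure_itv/= lte_fin ltrDl L0 -EFinD; congr (_%:E); ring.
(* The cells that meet E cover more than half of the interval. *)
have meet n : 2^-1 * 16 ^+ n <= \sum_(i < 16 ^ n) (`[< E `&` cell n i !=set0 >])%:R :> R.
  pose b i := `[< E `&` cell n i !=set0 >].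
  have h1 : (mu (E `&` `]a, (a + L)%R]) <= (\sum_(i < 16 ^ n) ((b i)%:R * l n)%:E)%E)%E.
    apply: (@le_trans _ _ (\sum_(i < 16 ^ n) mu (if b i then cell n i else set0))%E).
      apply: (@content_subadditive _ _ _ mu _ (fun i => if b i then cell n i else set0)).
      - by move=> k _; case: ifP => _; [exact: measurable_itv|exact: measurable0].
      - exact: (measurableI _ _ mE mI).
      - move=> x [Ex /(cell_cover n)[i i16 cx]]; rewrite -(bigcup_mkord _ (fun i => if b i then cell n i else set0)).
        by exists i => //; case: ifPn => // /asboolPn[]; exists x.
    apply: lee_sum => i _; case: (b i); last by rewrite measure0 mul0r.
    rewrite /cell lebesgue_measure_itv/= lte_fin mul1r ltrD2l ltr_pM2r// ltr_nat ltnSn.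
    by rewrite -EFinD lee_fin -natr1; lra.
  have := lt_le_trans Ebig h1; rewrite sumEFin lte_fin -mulr_suml => h2.
  have LE : 16 ^+ n * l n = L by rewrite /l mulrC divfK// expf_neq0.
  rewrite leNgt; apply/negP; rewrite -(ltr_pM2r (l_gt0 n)) -mulrA LE => h3.
  by have := lt_trans h2 h3; rewrite mulrC ltxx.
have Mbig n : (n0 <= n)%N -> 3 / 8 * 16 ^+ n <= \sum_(i < 16 ^ n) (M n i)%:R :> R.
  move=> /Gbig G7; have m2 := meet n.
  have : \sum_(i < 16 ^ n) (G n i)%:R + \sum_(i < 16 ^ n) (`[< E `&` cell n i !=set0 >])%:R
     <= \sum_(i < 16 ^ n) (M n i)%:R + 16 ^+ n :> R.
    have -> : 16 ^+ n = \sum_(i < 16 ^ n) 1 :> R.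
      by rewrite sumr_const card_ord -natrX.
    rewrite -!big_split/=; apply: ler_sum => i _.
    by rewrite /M; case: (G n i); case: asbool => /=; rewrite ?addr0 ?add0r.
  lra.
have [N hN] := hdiv 8.
pose w n := 3 / 8 * (h (n0 + n)%N * L).
pose o m n := 2 * 16 ^+ (n0 + m) * (h (n0 + n)%N * l (n0 + n)).
have hl n : 16 ^+ n * l n = L by rewrite /l mulrC divfK// expf_neq0.
have muI' : (mu `]a, (a + L)%R] <= L%:E)%E by rewrite muI.
have := @bonferroni_le _ _ R mu `]a, a + L]%classic (fun n => V (n0 + n)) L w o N mI muI' (fun n => mV _).
have VI n : V (n0 + n) `<=` `]a, a + L].
  by move=> x /VJ[i i16 /J_cell]; exact: cell_sub.
move=> /(_ VI).
have wV n : ((w n)%:E <= mu (V (n0 + n)))%E.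
  rewrite V_measure// lee_fin /w -(hl (n0 + n)).
  set k := (n0 + n)%N.
  have -> : 3 / 8 * (h k * (16 ^+ k * l k)) = 3 / 8 * 16 ^+ k * (h k * l k) by ring.
  by rewrite ler_wpM2r ?Mbig ?leq_addr// mulr_ge0// ltW.
move=> /(_ wV (fun m n _ => V_overlap _ _)).
apply/negP; rewrite -ltNge.
(* The overlaps with all the earlier levels take away at most 2 / 15 of h * L,
   which leaves more than 1 / 8 of the 3 / 8. *)
have geo n : \sum_(m < n) (16 ^+ (n0 + m) : R) <= 16 ^+ (n0 + n) / 15.
  elim: n => [|n IH]; first by rewrite big_ord0 divr_ge0// exprn_ge0.
  by rewrite big_ord_recr/= addnS exprS; lra.
have term n : 1 / 8 * L * h (n0 + n) <= w n - \sum_(m < n) o m n.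
  rewrite /w /o -mulr_suml -mulr_sumr.
  have g : 2 * (\sum_(i < n) 16 ^+ (n0 + i)) * (h (n0 + n) * l (n0 + n)) <=
      2 * (16 ^+ (n0 + n) / 15) * (h (n0 + n) * l (n0 + n)).
    have hl0 : 0 <= h (n0 + n) * l (n0 + n) by rewrite mulr_ge0// ltW.
    by apply: (ler_wpM2r hl0); apply: ler_wpM2l (geo n).
  have e : 2 * (16 ^+ (n0 + n) / 15) * (h (n0 + n) * l (n0 + n)) =
      2 / 15 * (h (n0 + n) * (16 ^+ (n0 + n) * l (n0 + n))) by field.
  rewrite e hl in g; have : 0 <= h (n0 + n) * L by rewrite mulr_ge0// ltW.
  lra.
apply: (@lt_le_trans _ _ (\sum_(n < N) (1 / 8 * L * h (n0 + n)))).
  by rewrite -mulr_sumr; move: hN; rewrite -(ltr_pM2l L0); lra.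
by apply: ler_sum => n _; exact: term.
Qed.
End ubiquity.

(** * Points of a shifted lattice in a given direction *)

(** Two of the [N + 1] fractional parts of [0, x, ..., N * x] lie in the same one
    of [N] boxes; dividing by the gcd only improves the approximation. *)
Lemma dirichlet (R : realType) (x : R) (N : nat) : (0 < N)%N ->
  exists (p : int) (q : nat), [/\ (0 < q <= N)%N, coprimez p q &
    `|q%:R * x - p%:~R| < N%:R^-1].
Proof.
move=> N0; have N0R : 0 < N%:R :> R by rewrite ltr0n.
pose fr (i : nat) := i%:R * x - (Num.floor (i%:R * x))%:~R.
have fr01 i : 0 <= fr i < 1.
  by have := floor_itv (i%:R * x); rewrite /fr intrD => /andP[]; lra.
pose f (i : 'I_N.+1) : 'I_N := insubd (Ordinal N0) (Num.trunc (N%:R * fr i)).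
have fE i : f i = Num.trunc (N%:R * fr i) :> nat.
  rewrite /f val_insubd truncn_lt_nat; last first.
    by rewrite mulr_ge0 ?ler0n//; have /andP[] := fr01 i.
  by rewrite -[ltRHS]mulr1 ltr_pM2l//; have /andP[_ ->] := fr01 i.
have [i [j [ij fij]]] : exists i j : 'I_N.+1, (i < j)%N /\ f i = f j.
  have /injectivePn[i [j ij fij]] : ~~ injectiveb f.
    by apply/negP => /injectiveP/leq_card; rewrite !card_ord ltnn.
  by case: (ltngtP i j) ij => [lt _|lt _|/val_inj ->]; [exists i, j|exists j, i|rewrite eqxx].
have close : `|fr j - fr i| < N%:R^-1.
  have ti := truncn_itv (mulr_ge0 (ltW N0R) (proj1 (andP (fr01 i)))).
  have tj := truncn_itv (mulr_ge0 (ltW N0R) (proj1 (andP (fr01 j)))).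
  rewrite -fE fij fE in ti.
  rewrite -(ltr_pM2l N0R) divff ?gt_eqF// -[X in X * `|_|]gtr0_norm// -normrM.
  rewrite mulrBr ltr_norml; move: ti tj; rewrite -!natr1.
  move=> /andP[ti1 ti2] /andP[tj1 tj2]; apply/andP; split; lra.
pose q0 := (j - i)%N; pose p0 := Num.floor (j%:R * x) - Num.floor (i%:R * x).
have q00 : (0 < q0)%N by rewrite subn_gt0.
have q0N : (q0 <= N)%N by rewrite (leq_trans (leq_subr _ _))// -ltnS ltn_ord.
have close0 : `|q0%:R * x - p0%:~R| < N%:R^-1.
  rewrite /q0 /p0 natrB ?(ltnW ij)// intrB.
  by move: close; rewrite /fr; congr (`|_| < _); ring.
pose g := gcdz p0 q0.
have gdp : (g %| p0)%Z by exact: dvdz_gcdl.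
have gdq : (g %| q0%:Z)%Z by exact: dvdz_gcdr.
have gq : (`|g| %| q0)%N by move: gdq; rewrite dvdzE.
have g0 : (0 < `|g|)%N.
  by rewrite absz_gt0 gcdz_eq0 negb_and/= -lt0n q00 orbT.
have gE : g = `|g|%N by rewrite gez0_abs.
have q0E : q0 = (q0 %/ `|g| * `|g|)%N.
  by rewrite divnK.
have p0E : p0 = (p0 %/ g)%Z * `|g|%N by rewrite -gE divzK.
exists (p0 %/ g)%Z, (q0 %/ `|g|)%N; split.
- rewrite divn_gt0// dvdn_leq//=.
  by rewrite (leq_trans (leq_div _ _)).
- apply/coprimezP; have [w [z wz]] := Bezoutz p0 q0; exists (w, z) => /=.
  have gn0 : g != 0 by rewrite gE -lt0n.
  apply: (mulIf gn0); rewrite mulrDl mul1r -!mulrA {1 2}gE -PoszM -p0E -q0E.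
  exact: wz.
- apply: le_lt_trans close0.
  rewrite [in leRHS]q0E [in leRHS]p0E natrM intrM mulrAC -mulrBl normrM.
  by rewrite ler_peMr// normr_nat ler1n.
Qed.

(** For [e < T], this says that the lattice obtained from the integral one by the
    shear of slope [x] and the diagonal flow at time [ln T] has a nonzero vector of
    size at most [e]. *)
Definition has_small_vector (R : realType) (e T x : R) : Prop :=
  exists (q : nat) (p : int), [/\ (0 < q)%N, q%:R <= e * T & `|q%:R * x - p%:~R| <= e / T].

(** Dirichlet's theorem at height [T / e] gives a reduced fraction [p / q] close to
    [x], and [q > e * T] since [x] has no small vector. By Bezout's identity the
    integers [n * p - m * q] take every value with [n] in any window of length [q]:
    a value within 1 of [q * (s1 - s2 * x)] makes the error of order [1 / q]. *)
Lemma shifted_lattice_point (R : realType) (s1 s2 e T x : R) :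
  0 < e -> e <= 1 / 4 -> 1 <= T -> `|s2| <= T -> ~ has_small_vector e T x ->
  exists m n : int, [/\ T <= n%:~R + s2, n%:~R + s2 <= (2 + e^-1) * T &
    `|(n%:~R + s2) * x - (m%:~R + s1)| <= 4 / (e * T)].
Proof.
move=> e0 e4 T1 sT good.
have T0 : 0 < T by lra.
pose N := (Num.trunc (T / e)).+1.
have NT : T / e < N%:R by exact: truncnS_gt.
have NT' : N%:R <= T / e + 1.
  by rewrite /N -natr1 lerD2r truncn_le divr_ge0// ltW.
have [p [q [/andP[q0 qN] cpq qx]]] := dirichlet x (ltn0Sn _ : (0 < N)%N).
have qxe : `|q%:R * x - p%:~R| <= e / T.
  apply: (le_trans (ltW qx)); rewrite -[e / T]invrK invf_div lef_pV2 ?posrE ?ltr0n ?divr_gt0//.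
  exact: ltW.
have qT : e * T < q%:R.
  by rewrite ltNge; apply/negP => qT; apply: good; exists q, p.
have q0R : 0 < q%:R :> R by rewrite ltr0n.
pose g := s1 - s2 * x.
pose j := Num.floor (q%:R * g).
have /andP[j1 j2] := floor_itv (q%:R * g); rewrite -/j intrD in j1 j2.
have [[u v] /= uv] := coprimezP _ _ cpq.
pose z := (T - s2 - (j * u)%:~R) / q%:R.
pose k := Num.floor z + 1.
have /andP[k1 k2] := floor_itv z.
have qz : z * q%:R = T - s2 - (j * u)%:~R by rewrite /z divfK// gt_eqF.
have k1' : T - s2 - (j * u)%:~R <= k%:~R * q%:R.
  by rewrite -qz ler_pM2r// ltW.
have k2' : k%:~R * q%:R <= T - s2 - (j * u)%:~R + q%:R.
  by rewrite -qz -{3}[q%:R]mul1r -mulrDl ler_pM2r// /k intrD lerD2r.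
pose n : int := j * u + k * q; pose m : int := - (j * v) + k * p.
have nE : n%:~R = (j * u)%:~R + k%:~R * q%:R :> R by rewrite /n intrD [(k * _)%:~R]intrM.
have n1 : T <= n%:~R + s2 by rewrite nE; lra.
have n2 : n%:~R + s2 <= (2 + e^-1) * T.
  have : q%:R <= T / e + 1 by apply: le_trans NT'; rewrite ler_nat.
  by rewrite nE mulrDl [e^-1 * T]mulrC; lra.
exists m, n; split => //.
have nm : n%:~R * p%:~R - m%:~R * q%:R = j%:~R :> R.
  have : n * p - m * q = j :> int.
    rewrite /n /m; transitivity (j * (u * p + v * q)); first by ring.
    by rewrite uv mulr1.
  by move=> /(congr1 (fun i : int => i%:~R : R)) <-; rewrite intrB !intrM.
have qe : q%:R * ((n%:~R + s2) * x - (m%:~R + s1)) =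
    n%:~R * (q%:R * x - p%:~R) + (j%:~R - q%:R * g) by rewrite -nm /g; ring.
have nn : `|n%:~R| <= 2 * (2 + e^-1) * T.
  have e1 : 0 < e^-1 by rewrite invr_gt0.
  have h : T <= (2 + e^-1) * T by rewrite ler_peMl; lra.
  move: sT; rewrite !ler_norml => /andP[? ?]; apply/andP; split; lra.
have main : `|q%:R * ((n%:~R + s2) * x - (m%:~R + s1))| <= 4.
  rewrite qe (le_trans (ler_normD _ _))//.
  have a1 : `|j%:~R - q%:R * g| <= 1 by rewrite ler_norml; apply/andP; split; lra.
  have a2 : `|n%:~R * (q%:R * x - p%:~R)| <= 3.
    rewrite normrM; apply: (@le_trans _ _ (2 * (2 + e^-1) * T * (e / T))).
      by apply: ler_pM.
    have -> : 2 * (2 + e^-1) * T * (e / T) = 4 * e + 2 by field; rewrite !gt_eqF.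
    lra.
  lra.
move: main; rewrite normrM normr_nat => main.
rewrite ler_pdivlMr ?mulr_gt0//; apply: le_trans main.
by rewrite mulrC ler_wpM2r// ltW.
Qed.
Lemma count_ge (R : realType) (z : R) (D : nat) : z <= D%:R ->
  \sum_(i < D) (z <= i%:R)%R%:R <= D%:R - z.
Proof.
elim: D => [|D IH] zD; first by rewrite big_ord0; lra.
rewrite big_ord_recr/=; have [zD'|Dz] := leP z D%:R.
  by have := IH zD'; rewrite -natr1 /= ?mulr1n; lra.
rewrite addr0 big1 ?subr_ge0// => i _.
suff -> : (z <= i%:R) = false by [].
by apply/negbTE; rewrite -ltNge (lt_trans _ Dz)// ltr_nat.
Qed.

(** The terms that satisfy the inequality are [l] apart in an interval of length
    [2 * r]. *)
Lemma count_progression (R : realType) (y l c r : R) (D : nat) : 0 < l -> 0 <= r ->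
  \sum_(i < D) (`|y + i%:R * l - c| <= r)%R%:R <= 2 * r / l + 1.
Proof.
move=> l0 r0; elim: D => [|D IH].
  by rewrite big_ord0 addr_ge0// divr_ge0// ?mulr_ge0// ltW.
have [|/negbTE h] := boolP (`|y + D%:R * l - c| <= r); last by rewrite big_ord_recr/= h addr0.
move=> last; pose z := (c - r - y) / l.
have zl : z * l = c - r - y by rewrite /z divfK// gt_eqF.
have DzR : D%:R - z <= 2 * r / l.
  rewrite ler_pdivlMr// mulrBl zl.
  by move: last; rewrite ler_norml => /andP[? ?]; lra.
have zD : z <= D%:R.
  by rewrite /z ler_pdivrMr//; move: last; rewrite ler_norml => /andP[? ?]; lra.
apply: (@le_trans _ _ (\sum_(i < D.+1) (z <= i%:R)%R%:R)).
  apply: ler_sum => i _; rewrite ler_nat; case: (boolP (_ <= r)) => //.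
  rewrite ler_norml => /andP[h1 h2].
  suff -> : z <= i%:R by [].
  by rewrite /z ler_pdivrMr//; lra.
apply: le_trans (count_ge _) _; first by rewrite -natr1; lra.
by rewrite -natr1; lra.
Qed.

(** Weaker than the logarithmic bound, but [M] can be chosen so that the second
    term is any given fraction of [Q]. *)
Lemma sum_inv_le (R : realType) (Q M : nat) : (0 < M)%N ->
  \sum_(q < Q) (q.+1%:R)^-1 <= M%:R + Q%:R / M%:R :> R.
Proof.
move=> M0; have M0R : 0 < M%:R :> R by rewrite ltr0n.
elim: Q => [|Q IH]; first by rewrite big_ord0 mul0r addr0 ler0n.
have [QM|MQ] := leqP Q.+1 M.
  apply: (@le_trans _ _ (\sum_(q < Q.+1) 1)).
    by apply: ler_sum => q _; rewrite invf_le1 ?ler1n ?ltr0n.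
  rewrite sumr_const card_ord.
  by apply: ler_wpDr; rewrite ?divr_ge0// ler_nat.
rewrite big_ord_recr/= -[Q.+1 in leRHS]addn1 natrD mulrDl addrA lerD//.
by rewrite mul1r lef_pV2 ?posrE ?ltr0n// ler_nat ltnW.
Qed.
(** For each denominator [q <= e * T] there are about [q * L] fractions [p / q] near
    the interval, each of which spoils at most [2 * e * T / q] centres. Hence at most
    about [5 * e ^ 2 * T ^ 2 * L] centres are spoiled, out of [L * e * T ^ 2 / 16]. *)
Lemma few_small_vectors (R : realType) (a L l e T : R) (D M : nat) :
  0 < e -> e <= 1 / 640 -> 0 < l -> L = D%:R * l -> T ^+ 2 * l = 16 / e ->
  1 <= T -> (0 < M)%N -> 3 <= M%:R * L -> 6 * M%:R <= e * L * T ->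
  \sum_(i < D) (`[< has_small_vector e T (a + l / 2 + i%:R * l) >])%:R <= D%:R / 8 :> R.
Proof.
move=> e0 e640 l0 LE Tl T1 M0 ML MT.
have T0 : 0 < T by lra.
have L0 : 0 < L by have := ltr0n R M; rewrite M0 => M0R; nra.
have eT0 : 0 < e * T by rewrite mulr_gt0.
have MR : 0 < M%:R :> R by rewrite ltr0n.
pose y i : R := a + l / 2 + i%:R * l.
pose Q := Num.trunc (e * T).
have QT : Q%:R <= e * T by rewrite truncn_le ltW.
(* K q bounds the number of numerators p for which p / q is near the interval,
   counted from the integral part of q * a. *)
pose K (q : nat) := (Num.trunc (q%:R * L)).+3.
have KL q : (K q)%:R <= q%:R * L + 3.
  have : (Num.trunc (q%:R * L))%:R <= q%:R * L by rewrite truncn_le mulr_ge0// ltW.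
  by rewrite /K -addn3 natrD; lra.
pose c (q k : nat) : R := (Num.floor (q%:R * a))%:~R + k%:R.
pose b i q k : bool := `|y i - c q k / q%:R| <= e / (T * q%:R).
have bad i : (i < D)%N -> (`[< has_small_vector e T (y i) >])%:R <=
    \sum_(q < Q) \sum_(k < K q.+1) (b i q.+1 k)%:R :> R.
  move=> iD; case: asboolP => [[q [p [q0 qT qy]]]|_]; last first.
    by apply: sumr_ge0 => q _; apply: sumr_ge0 => k _; rewrite ler0n.
  have q0R : 0 < q%:R :> R by rewrite ltr0n.
  have qQ : (q.-1 < Q)%N by rewrite prednK// /Q truncn_ge_nat// ltW.
  pose f := Num.floor (q%:R * a).
  have /andP[f1 f2] := floor_itv (q%:R * a); rewrite -/f intrD in f1 f2.
  have eT1 : e / T < 1 by rewrite ltr_pdivrMr//; lra.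
  have ya : a <= y i.
    have : 0 <= i%:R * l by rewrite mulr_ge0// ltW.
    by rewrite /y; lra.
  have yL : y i <= a + L.
    have : i.+1%:R * l <= D%:R * l by rewrite ler_pM2r// ler_nat.
    by rewrite -natr1 /y LE; lra.
  have qya : q%:R * a <= q%:R * y i by rewrite ler_pM2l.
  have qyL : q%:R * y i <= q%:R * a + q%:R * L by rewrite -mulrDr ler_pM2l.
  have /andP[qy1 qy2] : (- (e / T) <= q%:R * y i - p%:~R <= e / T) by rewrite -ler_norml.
  have pf : f <= p.
    have : (f - 1)%:~R < p%:~R :> R by rewrite intrB; lra.
    by rewrite ltr_int ltrBlDr -ltzD1 addrC.
  have pk : p = f + `|p - f|%N by rewrite gez0_abs ?subr_ge0//; ring.
  have kK : (`|p - f| < K q)%N.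
    have t1 := truncnS_gt (q%:R * L).
    rewrite /K -(ltr_nat R) -[`|p - f|%N%:R]/(`|p - f|%N%:Z%:~R) gez0_abs ?subr_ge0// intrB.
    by move: t1; rewrite -!natr1; lra.
  rewrite (bigD1 (Ordinal qQ))//= prednK//.
  rewrite (bigD1 (Ordinal kK))//=.
  have -> : b i q `|p - f|%N.
    rewrite /b /c -/f.
    have -> : f%:~R + `|p - f|%N%:R = p%:~R :> R by rewrite {2}pk intrD.
    have -> : y i - p%:~R / q%:R = (q%:R * y i - p%:~R) / q%:R.
      by field; rewrite gt_eqF.
    rewrite normrM normfV normr_nat invfM mulrA ler_pM2r ?invr_gt0//.
  rewrite -addrA lerDl addr_ge0//.
    by apply: sumr_ge0 => k _; rewrite ler0n.
  by apply: sumr_ge0 => q' _; apply: sumr_ge0 => k _; rewrite ler0n.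
have inner q k : (q < Q)%N -> \sum_(i < D) (b i q.+1 k)%:R <= 2 * (e * T) / q.+1%:R :> R.
  move=> qQ; have q0R : 0 < q.+1%:R :> R by rewrite ltr0n.
  have qT : q.+1%:R <= e * T by apply: le_trans QT; rewrite ler_nat.
  have r0 : 0 <= e / (T * q.+1%:R) by rewrite divr_ge0 ?mulr_ge0// ltW.
  apply: le_trans (count_progression _ _ _ l0 r0) _.
  have lE : l = 16 / e / T ^+ 2 by rewrite -Tl mulrC mulKf// expf_neq0// gt_eqF.
  have -> : 2 * (e / (T * q.+1%:R)) / l = (e / 8) * (e * T / q.+1%:R).
    by rewrite lE; field; rewrite !gt_eqF// addr_gt0.
  have t1 : 1 <= e * T / q.+1%:R by rewrite ler_pdivlMr// mul1r.
  have -> : 2 * (e * T) / q.+1%:R = 2 * (e * T / q.+1%:R) by rewrite !mulrA.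
  by move: (e * T / q.+1%:R) t1 => X X1; nra.
apply: (@le_trans _ _ (\sum_(i < D) \sum_(q < Q) \sum_(k < K q.+1) (b i q.+1 k)%:R)).
  by apply: ler_sum => i _; exact: bad.
rewrite exchange_big/=.
apply: (@le_trans _ _ (\sum_(q < Q) (2 * (e * T) * L + 6 * (e * T) * (q.+1%:R)^-1))).
  apply: ler_sum => q _; rewrite exchange_big/=.
  have q0R : 0 < q.+1%:R :> R by rewrite ltr0n.
  apply: (@le_trans _ _ (\sum_(k < K q.+1) (2 * (e * T) / q.+1%:R))).
    by apply: ler_sum => k _; exact: inner.
  rewrite sumr_const card_ord -[leLHS]mulr_natl.
  apply: (@le_trans _ _ ((q.+1%:R * L + 3) * (2 * (e * T) / q.+1%:R))).
    by rewrite ler_pM2r// ?divr_gt0// mulr_gt0.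
  by rewrite le_eqVlt; apply/orP; left; apply/eqP; field; rewrite gt_eqF// addr_gt0.
rewrite big_split/= sumr_const card_ord -mulr_sumr -[X in X + _]mulr_natl.
have inv := sum_inv_le R Q M0.
(* Main terms: 2 from L * q, 1 + 2 from the constant 3 in K, split by sum_inv_le. *)
have S1 : Q%:R * (2 * (e * T) * L) <= 2 * (e * T) ^+ 2 * L.
  have h : 0 < 2 * (e * T) * L by rewrite !mulr_gt0.
  have := ler_pM2r h Q%:R (e * T); rewrite QT => /idP; lra.
have S2 : 6 * (e * T) * (\sum_(q < Q) (q.+1%:R)^-1) <= 6 * (e * T) * (M%:R + Q%:R / M%:R).
  by rewrite ler_pM2l// mulr_gt0.
have S3 : 6 * (e * T) * M%:R <= (e * T) ^+ 2 * L.
  have := ler_pM2l eT0 (6 * M%:R) (e * L * T); rewrite MT => /idP; lra.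
have S4 : 6 * (e * T) * (Q%:R / M%:R) <= 2 * (e * T) ^+ 2 * L.
  apply: (@le_trans _ _ (6 * (e * T) * ((e * T) / M%:R))).
    by rewrite ler_pM2l ?mulr_gt0// ler_pM2r// invr_gt0.
  have m3 : 3 / M%:R <= L by rewrite ler_pdivrMr// mulrC.
  have h : 0 < 2 * (e * T) ^+ 2 by rewrite mulr_gt0// exprn_gt0.
  have := ler_pM2l h (3 / M%:R) L; rewrite m3 => /idP; lra.
have DE : D%:R * 16 = L * e * T ^+ 2.
  have l16 : T ^+ 2 * l * e = 16 by rewrite Tl divfK// gt_eqF.
  by rewrite -l16 LE; ring.
have LT : 0 < L * e * T ^+ 2 by rewrite !mulr_gt0// exprn_gt0.
have fin : 5 * ((e * T) ^+ 2 * L) <= D%:R / 8.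
  have -> : D%:R / 8 = L * e * T ^+ 2 / 128 by rewrite -DE; field.
  have -> : 5 * ((e * T) ^+ 2 * L) = 5 * e * (L * e * T ^+ 2) by ring.
  nra.
lra.
Qed.

(** * Divergence along geometric sequences *)

(** The properties of [phi] used below; unlike the divergence of the integral, the
    last one passes at once to [phi (k * t) / k]. *)
Record approx_fun (R : realType) (phi : R -> R) : Prop := ApproxFun {
  approx_gt0 : forall t : R, 0 <= t -> 0 < phi t;
  approx_decr : forall s t : R, 1 <= s -> s <= t -> t * phi t <= s * phi s;
  approx_div : forall t0 : R, 1 <= t0 -> forall B : R, exists N : nat,
    B < \sum_(n < N) t0 * 4 ^+ n * phi (t0 * 4 ^+ n) }.

Lemma nonincreasing_of_mul (R : realType) (phi : R -> R) :
  (forall t : R, 0 <= t -> 0 < phi t) ->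
  (forall s t : R, 1 <= s -> s <= t -> t * phi t <= s * phi s) ->
  forall s t : R, 1 <= s -> s <= t -> phi t <= phi s.
Proof.
move=> phi0 phid s t s1 st; have t0 : 0 < t by lra.
rewrite -(ler_pM2l t0); apply: (le_trans (phid _ _ s1 st)).
by rewrite ler_pM2r// phi0//; lra.
Qed.

(** On each interval between consecutive terms of the geometric sequence [phi] is
    at most its value at the left end, so the series bounds the integral. *)
Lemma geometric_series_diverges (R : realType) (phi : R -> R) :
  (forall t : R, 0 <= t -> 0 < phi t) ->
  (forall s t : R, 1 <= s -> s <= t -> t * phi t <= s * phi s) ->
  (\int[lebesgue_measure]_(t in `[1%R, +oo[) (phi t)%:E = +oo)%E ->
  forall t0 : R, 1 <= t0 -> forall B : R, exists N : nat,
    B < \sum_(n < N) t0 * 4 ^+ n * phi (t0 * 4 ^+ n).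
Proof.
move=> phi0 phid phiI t0 t01 B; apply: contrapT => noN.
have {noN} bound N : \sum_(n < N) t0 * 4 ^+ n * phi (t0 * 4 ^+ n) <= B.
  by rewrite leNgt; apply/negP => h; apply: noN; exists N.
have phi_ni := nonincreasing_of_mul phi0 phid.
(* The extra initial interval starts at 1, where the integral does. *)
pose b n : R := if n is n'.+1 then t0 * 4 ^+ n' else 1.
have bS n : b n <= b n.+1.
  case: n => [|n] /=; first by rewrite expr0 mulr1.
  have : 0 < t0 * 4 ^+ n by rewrite mulr_gt0 ?exprn_gt0//; lra.
  by rewrite exprS; lra.
have bmono m n : (m <= n)%N -> b m <= b n.
  elim: n => [|n IH]; first by rewrite leqn0 => /eqP ->.
  by rewrite leq_eqVlt ltnS => /orP[/eqP -> //|/IH/le_trans]; apply.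
have b1 n : 1 <= b n by exact: (@bmono 0%N).
pose F n : set R := `[b n, b n.+1[%classic.
have mF n : measurable (F n) by exact: measurable_itv.
have tF : trivIset [set: nat] F.
  move=> i j _ _ [x []]; rewrite /F/= !in_itv/= => /andP[x1 x2] /andP[x3 x4].
  have [ij|ji|//] := ltngtP i j.
    by have := lt_le_trans x2 (le_trans (bmono _ _ ij) x3); rewrite ltxx.
  by have := lt_le_trans x4 (le_trans (bmono _ _ ji) x1); rewrite ltxx.
have UF : `[1%R, +oo[%classic = \bigcup_n F n.
  apply/seteqP; split => [x|x [n _]]; rewrite /F/= !in_itv/= ?andbT; last first.
    by move=> /andP[+ _]; exact: le_trans.
  move=> x1; have [n] : exists n, x < b n.
    exists (Num.bound x).+1 => /=.
    apply: lt_le_trans (archi_boundP _) _; first lra.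
    have : (Num.bound x)%:R <= 4 ^+ Num.bound x :> R.
      by rewrite -natrX ler_nat ltnW// ltn_expl.
    have : 0 < 4 ^+ Num.bound x :> R by rewrite exprn_gt0.
    nra.
  elim: n => [|n IH] xn; first by move: (lt_le_trans xn x1); rewrite ltxx.
  have [/IH//|bx] := ltP x (b n).
  by exists n => //=; rewrite in_itv/= bx.
(* Monotone on the whole line, hence measurable. *)
pose ph t := phi (Num.max 1 t).
have mph : measurable_fun setT ph.
  apply: nonincreasing_measurable => // x y xy; rewrite /ph.
  apply: phi_ni; first by rewrite le_max lexx.
  by rewrite ge_max le_max lexx/= le_max xy orbT.
have mphi (D : set R) : D `<=` `[1%R, +oo[%classic -> measurable D -> measurable_fun D (EFin \o phi).
  move=> D1 mD; apply/measurable_EFinP.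
  apply: (eq_measurable_fun ph); last exact: measurable_funTS.
  move=> x; rewrite inE => /D1; rewrite /= in_itv/= andbT => x1.
  by rewrite /ph; have /max_idPr -> := x1.
have FD n : F n `<=` `[1%R, +oo[%classic by rewrite UF; exact: bigcup_sup.
have int_le n : (\int[lebesgue_measure]_(t in F n) (phi t)%:E <=
    (phi (b n) * (b n.+1 - b n))%:E)%E.
  apply: (@le_trans _ _ (\int[lebesgue_measure]_(t in F n) cst (phi (b n))%:E t)%E).
    apply: ge0_le_integral; first exact: mF.
    - move=> x Fx; have := FD n x Fx; rewrite /= in_itv/= andbT => x1.
      by rewrite lee_fin ltW// phi0//; lra.
    - exact: mphi.
    - exact: measurable_cst.
    - move=> x; rewrite /F/= in_itv/= => /andP[bx _]; rewrite lee_fin.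
      exact: phi_ni.
  rewrite integral_cst; last exact: mF.
  have muF : lebesgue_measure (F n) = (b n.+1 - b n)%:E.
    rewrite /F; move: (b n) (b n.+1) (bS n) => x y xy.
    rewrite lebesgue_measure_itv/= lte_fin.
    move: xy; rewrite le_eqVlt => /orP[/eqP <-|xy]; first by rewrite ltxx subrr.
    by rewrite xy EFinD.
  rewrite [X in (_ * X <= _)%E](_ : _ = (b n.+1 - b n)%:E); last exact: muF.
  by rewrite -EFinM.
have mU : measurable_fun (\bigcup_n F n) (EFin \o phi).
  by apply: mphi; rewrite -UF//; exact: measurable_itv.
move: phiI; rewrite UF ge0_integral_bigcup//; last first.
  move=> x; rewrite -UF/= in_itv/= andbT => x1.
  by rewrite lee_fin ltW// phi0//; lra.
have nn n : (0 <= \int[lebesgue_measure]_(t in F n) (phi t)%:E)%E.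
  apply: integral_ge0 => x Fx; have := FD n x Fx; rewrite /= in_itv/= andbT => x1.
  by rewrite lee_fin ltW// phi0//; lra.
apply/eqP; rewrite lt_eqF//.
apply: (@le_lt_trans _ _ (phi 1 * (t0 - 1) + 3 * B)%:E); last by rewrite ltry.
apply: lime_le; first exact: is_cvg_nneseries.
apply: nearW => n; rewrite big_mkord.
apply: (@le_trans _ _ (\sum_(i < n) (phi (b i) * (b i.+1 - b i))%:E)%E).
  by apply: lee_sum => i _; exact: int_le.
rewrite sumEFin lee_fin.
case: n => [|n].
  rewrite big_ord0; have := bound 0%N; rewrite big_ord0 => B0.
  by rewrite addr_ge0// mulr_ge0// ?subr_ge0// ltW// phi0.
rewrite big_ord_recl/= expr0 mulr1 lerD2l.
apply: le_trans (ler_wpM2l _ (bound n)); last by [].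
rewrite mulr_sumr; apply: ler_sum => i _ /=.
by rewrite le_eqVlt; apply/orP; left; apply/eqP; rewrite exprS; ring.
Qed.

(** * Inhomogeneous approximation for almost every slope *)

Lemma expr_unbounded (R : realType) (c B : R) : 0 < c -> exists n : nat, forall k, (n <= k)%N -> B <= c * 4 ^+ k.
Proof.
move=> c0; exists (Num.bound (`|B| / c)) => k nk.
have h : `|B| / c < (Num.bound (`|B| / c))%:R.
  by apply: archi_boundP; rewrite divr_ge0// ltW.
have h2 : (Num.bound (`|B| / c))%:R <= 4 ^+ k :> R.
  by rewrite -natrX ler_nat (leq_trans nk)// ltnW// ltn_expl.
have := lt_le_trans h h2; rewrite ltr_pdivrMr// => h3.
by rewrite (le_trans (ler_norm B))// ltW// mulrC.
Qed.

Section slope.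
Variables (R : realType) (phi : R -> R) (s1 s2 : R).
Hypothesis (phiP : approx_fun phi).

Let miss (N : nat) : set R := [set x | forall m n : int,
  N.+1%:R <= n%:~R + s2 -> phi (n%:~R + s2) <= `|(n%:~R + s2) * x - (m%:~R + s1)|].

Let slope_ball (c w x : R) : 0 < w ->
  (`|w * x - c| < phi w) = (x \in `](c - phi w) / w, (c + phi w) / w[).
Proof.
move=> w0; rewrite in_itv/= ltr_pdivrMr// ltr_pdivlMr// ltr_norml.
by apply/idP/idP => /andP[? ?]; apply/andP; split; lra.
Qed.

Let measurable_miss N : measurable (miss N).
Proof.
pose A (mn : int * int) : set R := `](mn.1%:~R + s1 - phi (mn.2%:~R + s2)) / (mn.2%:~R + s2),
  (mn.1%:~R + s1 + phi (mn.2%:~R + s2)) / (mn.2%:~R + s2)[%classic.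
have -> : miss N = ~` (\bigcup_(mn in [set mn : int * int | N.+1%:R <= mn.2%:~R + s2]) A mn).
  have w0 (n : int) : N.+1%:R <= n%:~R + s2 -> 0 < n%:~R + s2.
    by apply: lt_le_trans; rewrite ltr0n.
  apply/seteqP; split => x /=.
    move=> mx [[m n] /= Nn Ax]; have := mx m n Nn.
    by rewrite leNgt slope_ball ?w0//; apply/negP/negPn; exact: Ax.
  move=> nA m n Nn; rewrite leNgt; apply/negP; rewrite slope_ball ?w0// => Ax.
  by apply: nA; exists (m, n).
apply: measurableC; apply: open_measurable; apply: bigcup_open => mn _.
exact: interval_open.
Qed.

(** At level [n], a cell whose centre has no small vector contains the interval of
    radius [h n * l n / 2] around a fraction [(m + s1) / (n + s2)] of size [T n], and
    [phi] is large enough for that interval to be approximated. *)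
Let miss_half N (a b : R) : a < b ->
  (lebesgue_measure (miss N `&` `]a, b]) <= ((b - a) / 2)%:E)%E.
Proof.
move=> ab; pose L := b - a; have L0 : 0 < L by rewrite subr_gt0.
have phi_gt0 := approx_gt0 phiP; have phi_decr := approx_decr phiP.
(* The value needed for at most one cell in eight to be bad. *)
have [e [e0 e640]] : exists e : R, 0 < e /\ e <= 1 / 640 by exists (1 / 640); split; lra.
(* The scale T n for which a quarter of a cell is 4 / (e * T n ^ 2), the distance
   at which shifted_lattice_point finds a fraction. *)
pose tau := Num.sqrt (16 / (e * L)).
have tau2 : tau ^+ 2 * L = 16 / e.
  rewrite sqr_sqrtr; last by rewrite divr_ge0// mulr_ge0// ltW.
  by field; rewrite !gt_eqF.
have tau0 : 0 < tau by rewrite sqrtr_gt0 divr_gt0// mulr_gt0.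
pose T n : R := tau * 4 ^+ n.
pose l n : R := L / 16 ^+ n.
have l0 n : 0 < l n by rewrite divr_gt0// exprn_gt0.
have T0 n : 0 < T n by rewrite mulr_gt0// exprn_gt0.
have Tl n : T n ^+ 2 * l n = 16 / e.
  rewrite /T /l -tau2 exprMn -exprM mulnC exprM.
  have -> : (4 : R) ^+ 2 = 16 by ring.
  by rewrite mulrACA mulfV ?mulr1// expf_neq0.
pose M := (Num.trunc (3 / L)).+1.
have ML : 3 <= M%:R * L by rewrite -ler_pdivrMr// ltW// truncnS_gt.
pose c2 : R := 2 + e^-1.
have c20 : 1 <= c2 by have : 0 < e^-1 by [rewrite invr_gt0]; rewrite /c2; lra.
have [n0 n0P] : exists n0 : nat, forall n, (n0 <= n)%N ->
    [/\ 1 <= T n, `|s2| <= T n, N.+1%:R <= T n & 6 * M%:R <= e * L * T n].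
  have [n0 n0P] := expr_unbounded (1 + `|s2| + N.+1%:R + 6 * M%:R / (e * L)) tau0.
  exists n0 => n /n0P; rewrite -/(T n).
  have h1 := normr_ge0 s2; have h2 : 0 <= N.+1%:R :> R by rewrite ler0n.
  have eL : 0 < e * L by rewrite mulr_gt0.
  have h3 : 0 <= 6 * M%:R / (e * L) by rewrite divr_ge0 ?mulr_ge0// ltW.
  move=> h4; split; try lra.
  by rewrite [leRHS]mulrC -ler_pdivrMr//; lra.
(* The first term of the denominator keeps the intervals inside the set of
   approximated slopes, the second one makes them fit in half a cell. *)
pose c' : R := (8 * c2 ^+ 2 / e + 2 * phi 1)^-1.
have p1 : 0 < phi 1 by exact: phi_gt0.
have c2e : 0 < 8 * c2 ^+ 2 / e by rewrite divr_gt0// mulr_gt0// exprn_gt0//; lra.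
have c'0 : 0 < c' by rewrite invr_gt0; lra.
have c'1 : c' * (8 * c2 ^+ 2 / e) <= 1.
  by rewrite mulrC ler_pdivrMr; lra.
have c'2 : c' * phi 1 <= 1 / 2.
  by rewrite mulrC ler_pdivrMr; lra.
pose t n := c2 * T n.
have t0 n : 0 < t n by rewrite mulr_gt0//; lra.
pose h n : R := c' * (t n * phi (t n)).
have h0 n : 0 <= h n.
  by rewrite mulr_ge0 ?(ltW c'0)// mulr_ge0 ?(ltW (t0 n))// ltW// phi_gt0// ltW.
pose y n i : R := a + l n / 2 + i%:R * l n.
pose G n i : bool := (n0 <= n)%N && `[< ~ has_small_vector e (T n) (y n i) >].
have [uv uvP] : exists uv : nat -> nat -> R * R, forall n i, G n i ->
    [/\ a + i%:R * l n <= (uv n i).1, (uv n i).2 <= a + i.+1%:R * l n,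
     (uv n i).2 - (uv n i).1 = h n * l n & miss N `&` `](uv n i).1, (uv n i).2[ = set0].
  suff : forall ni : nat * nat, exists uv : R * R, G ni.1 ni.2 ->
    [/\ a + ni.2%:R * l ni.1 <= uv.1, uv.2 <= a + ni.2.+1%:R * l ni.1,
     uv.2 - uv.1 = h ni.1 * l ni.1 & miss N `&` `]uv.1, uv.2[ = set0].
    move=> /choice[uv uvP]; exists (fun n i => uv (n, i)) => n i.
    exact: uvP (n, i).
  move=> [n i] /=; have [Gni|_] := boolP (G n i); last by exists (0, 0).
  move: Gni => /andP[n0n /asboolP good].
  have [T1 sT NT _] := n0P _ n0n.
  have e4 : e <= 1 / 4 by lra.
  have [m [k [k1 k2 k3]]] := @shifted_lattice_point R s1 s2 e (T n) (y n i) e0 e4 T1 sT good.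
  set w := k%:~R + s2 in k1 k2 k3 *.
  rewrite -/c2 -/(t n) in k2.
  have w0 : 0 < w by lra.
  pose z := (m%:~R + s1) / w.
  have zw : w * z = m%:~R + s1 by rewrite /z mulrCA divff ?mulr1// gt_eqF.
  pose r := h n * l n / 2.
  have r0 : 0 <= r by rewrite divr_ge0// mulr_ge0// ltW.
  have t1 : 1 <= t n by rewrite /t; nra.
  have rl : r <= l n / 4.
    have hn : h n <= 1 / 2.
      apply: le_trans c'2; rewrite /h ler_pM2l//.
      by have := phi_decr 1 (t n) (lexx 1) t1; rewrite mul1r.
    by rewrite /r; have := l0 n; nra.
  have zy : `|y n i - z| <= l n / 4.
    rewrite -(ler_pM2l w0) -{1}[w]gtr0_norm// -normrM mulrBr zw.
    apply: (le_trans k3).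
    apply: (@le_trans _ _ (T n * (l n / 4))); last by rewrite ler_pM2r// divr_gt0.
    rewrite ler_pdivrMr ?mulr_gt0//.
    have -> : T n * (l n / 4) * (e * T n) = (T n ^+ 2 * l n) * e / 4 by ring.
    by rewrite Tl divfK ?gt_eqF//; lra.
  have rphi : w * r <= phi w.
    rewrite -(ler_pM2l w0).
    apply: (@le_trans _ _ (t n * phi (t n))); last by apply: phi_decr => //; lra.
    apply: (@le_trans _ _ (t n ^+ 2 * r)).
      rewrite mulrA -expr2 ler_wpM2r// ler_sqr ?nnegrE// ltW//.
    have -> : t n ^+ 2 * r = c' * (c2 ^+ 2 * (T n ^+ 2 * l n) / 2) * (t n * phi (t n)).
      by rewrite /r /h {1}/t; ring.
    have tphi : 0 <= t n * phi (t n).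
      by apply: mulr_ge0; apply: ltW => //; apply: phi_gt0; exact: ltW.
    rewrite Tl -[leRHS]mul1r; apply: (ler_wpM2r tphi).
    apply: le_trans c'1; rewrite ler_pM2l//.
    by rewrite le_eqVlt; apply/orP; left; apply/eqP; field; rewrite gt_eqF.
  exists (z - r, z + r) => _ /=.
  move: zy; rewrite ler_norml => /andP[zy1 zy2].
  rewrite -[i.+1%:R]natr1 mulrDl mul1r.
  rewrite /y in zy1 zy2; split; [lra|lra|by rewrite /r; field|].
  apply/seteqP; split => // x [/= mx].
  rewrite in_itv/= => /andP[x1 x2].
  have := mx m k (le_trans NT k1); rewrite -/w leNgt => /negP; apply.
  apply: lt_le_trans rphi; rewrite -zw -mulrBr normrM gtr0_norm// ltr_pM2l//.
  by rewrite ltr_norml; apply/andP; split; lra.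
have bE : b = a + L by rewrite /L; ring.
rewrite -/L bE.
apply: (@ubiquity R (miss N) a L (fun n i => (uv n i).1) (fun n i => (uv n i).2) h G n0) => //.
- by move=> n i /uvP[].
- by move=> n i /uvP[].
- move=> n n0n; have [T1 sT NT MT] := n0P _ n0n.
  have LE : L = (16 ^ n)%:R * l n by rewrite natrX /l mulrC divfK// expf_neq0.
  have := @few_small_vectors R a L (l n) e (T n) (16 ^ n) M e0 e640 (l0 n) LE (Tl n) T1 (ltn0Sn _) ML MT.
  rewrite natrX.
  have : \sum_(i < 16 ^ n) (G n i)%:R +
      \sum_(i < 16 ^ n) (`[< has_small_vector e (T n) (y n i) >])%:R = 16 ^+ n :> R.
    rewrite -big_split/=.
    have -> : 16 ^+ n = \sum_(i < 16 ^ n) 1 :> R by rewrite sumr_const card_ord natrX.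
    apply: eq_bigr => i _; rewrite /G n0n/= asbool_neg.
    by case: asboolP => _ /=; rewrite ?add0r ?addr0.
  by rewrite /y; lra.
- move=> B.
  have t1 : 1 <= t n0 by have [T1 _ _ _] := n0P _ (leqnn n0); rewrite /t; nra.
  have [K BK] := approx_div phiP t1 (B / c').
  exists K; rewrite /h -mulr_sumr mulrC -ltr_pdivrMr//.
  apply: (lt_le_trans BK); apply: ler_sum => n _.
  have -> : t (n0 + n)%N = t n0 * 4 ^+ n by rewrite /t /T exprD !mulrA.
  by [].
Qed.

Theorem slope_khinchin : lebesgue_measure.-negligible
  [set x | ~ forall N : nat, exists m n : int, N%:R <= n%:~R + s2 /\
      `|(n%:~R + s2) * x - (m%:~R + s1)| < phi (n%:~R + s2)].
Proof.
have missN : lebesgue_measure.-negligible (\bigcup_N miss N).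
  apply: negligible_bigcup => N; apply/negligibleP; first exact: measurable_miss.
  apply: null_of_half_density; first exact: measurable_miss.
  exact: miss_half.
apply: negligibleS missN.
move=> x /= /existsNP[N noN]; exists N => // m n Nn.
rewrite leNgt; apply/negP => lt_phi; apply: noN; exists m, n; split => //.
by apply: le_trans Nn; rewrite ler_nat.
Qed.
End slope.

(** * From slopes to angles *)

Lemma negligible_bigcup_count d (T : measurableType d) (R : realType)
    (mu : {measure set T -> \bar R}) (I : countType) (F : I -> set T) :
  (forall i, mu.-negligible (F i)) -> mu.-negligible (\bigcup_i F i).
Proof.
move=> F0; pose F' n := if unpickle n is Some i then F i else set0.
apply: (@negligibleS _ _ _ mu (\bigcup_n F' n)).
  by move=> x [i _ Fix]; exists (pickle i) => //; rewrite /F' pickleK.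
apply: negligible_bigcup => n; rewrite /F'.
by case: unpickle => [i|]; [exact: F0|exact: negligible_set0].
Qed.

Lemma sin_intpi (R : realType) (k : int) : sin (k%:~R * pi) = 0 :> R.
Proof.
have sinn (n : nat) : sin (n%:R * pi) = 0 :> R.
  elim: n => [|n IH]; first by rewrite mul0r sin0.
  by rewrite -natr1 mulrDl mul1r sinDpi IH oppr0.
case: k => n; first exact: sinn.
by rewrite NegzE mulrNz mulNr sinN sinn oppr0.
Qed.

(** The arctangent inverts the tangent on one period only, so that angles are first
    brought there; the factor [c] is the sign lost by the shift. *)
Lemma shift_intpi (R : realType) (u : R) :
  exists2 k : int, - (pi / 2) < u - k%:~R * pi <= pi / 2 &
    exists2 c : R, c != 0 & cos u = c * cos (u - k%:~R * pi) /\
                            sin u = c * sin (u - k%:~R * pi).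
Proof.
have p0 : 0 < pi :> R := pi_gt0 R.
pose k : int := - Num.floor (2^-1 - u / pi).
have /andP[k1 k2] := floor_itv (2^-1 - u / pi); rewrite intrD in k2.
exists k.
  have up : u / pi * pi = u by rewrite divfK// gt_eqF.
  set f := Num.floor _ in k k1 k2 *.
  rewrite /k mulrNz mulNr opprK.
  have h1 : f%:~R * pi <= (2^-1 - u / pi) * pi by rewrite ler_pM2r.
  have h2 : (2^-1 - u / pi) * pi < (f%:~R + 1) * pi by rewrite ltr_pM2r.
  rewrite mulrBl up in h1 h2; rewrite mulrDl mul1r in h2.
  by apply/andP; split; lra.
exists (cos (k%:~R * pi)).
  apply/eqP => c0; have := cos2Dsin2 (k%:~R * pi : R).
  by rewrite c0 sin_intpi expr0n addr0 => /esym/eqP; rewrite oner_eq0.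
have : u = (u - k%:~R * pi) + k%:~R * pi by ring.
move: (u - k%:~R * pi) => v ->.
by rewrite cosD sinD sin_intpi !mulr0 subr0 addr0 mulrC [sin _ * _]mulrC.
Qed.

Lemma polar_form (R : realType) (a b : R) : (a, b) != (0, 0) ->
  exists rho alpha : R, [/\ 0 < rho, a = rho * cos alpha & b = rho * sin alpha].
Proof.
move=> ab0; pose rho := Num.sqrt (a ^+ 2 + b ^+ 2).
have s0 : 0 < a ^+ 2 + b ^+ 2.
  rewrite lt_neqAle addr_ge0 ?sqr_ge0// andbT eq_sym paddr_eq0 ?sqr_ge0//.
  by rewrite !sqrf_eq0; move: ab0; rewrite xpair_eqE.
have rho0 : 0 < rho by rewrite sqrtr_gt0.
have rho2 : rho ^+ 2 = a ^+ 2 + b ^+ 2 by rewrite sqr_sqrtr// ltW.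
have c1 : -1 <= a / rho <= 1.
  rewrite -ler_norml normrM normfV (gtr0_norm rho0) ler_pdivrMr// mul1r.
  by rewrite -ler_sqr ?nnegrE ?(ltW rho0)// real_normK ?num_real// rho2 lerDl sqr_ge0.
have sE : sin (acos (a / rho)) = `|b| / rho.
  rewrite sin_acos//; apply/eqP; rewrite -(eqrXn2 (ltn0Sn 1)) ?nnegrE ?sqrtr_ge0 ?divr_ge0 ?(ltW rho0)//.
  rewrite sqr_sqrtr; last first.
    by move: (a / rho) c1 => x /andP[x1 x2]; nra.
  rewrite !expr_div_n real_normK ?num_real// rho2; apply/eqP; field.
  by rewrite gt_eqF.
have ca : rho * cos (acos (a / rho)) = a.
  by rewrite acosK ?in_itv//= mulrCA divff ?mulr1// gt_eqF.
have sa : rho * sin (acos (a / rho)) = `|b|.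
  by rewrite sE mulrCA divff ?mulr1// gt_eqF.
have [b0|b0] := leP 0 b.
  by exists rho, (acos (a / rho)); rewrite ca sa ger0_norm.
by exists rho, (- acos (a / rho)); rewrite cosN sinN mulrN ca sa ltr0_norm// opprK.
Qed.

(** These angles differ by multiples of [pi], so they form a countable set. *)
Lemma negligible_orthogonal (R : realType) (a b : R) : (a, b) != (0, 0) ->
  lebesgue_measure.-negligible [set t : R | cos t * a - sin t * b = 0].
Proof.
move=> /polar_form[rho [al [rho0 -> ->]]].
have : lebesgue_measure.-negligible
    (\bigcup_(k : int) [set (pi / 2 + k%:~R * pi - al : R)]).
  apply: negligible_bigcup_count => k; apply/negligibleP => //.
  exact: lebesgue_measure_set1.
apply: negligibleS => t /= t0.
have {}t0 : cos (t + al) = 0.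
  by apply: (mulfI (lt0r_neq0 rho0)); rewrite mulr0 -[RHS]t0 cosD; ring.
have [k /andP[k1 k2] [c c0 [cu _]]] := shift_intpi (t + al).
exists k => //=; suff : t + al - k%:~R * pi = pi / 2 by lra.
apply/eqP; rewrite eq_le k2/= leNgt; apply/negP => k3.
have : 0 < cos (t + al - k%:~R * pi) by apply: cos_gt0_pihalf; rewrite k1 k3.
by move/lt0r_neq0/eqP; apply; apply: (mulfI c0); rewrite mulr0 -cu.
Qed.

Lemma atan_lipschitz (R : realType) (x y : R) : `|atan x - atan y| <= `|x - y|.
Proof.
wlog xy : x y / x < y.
  move=> H; have [xy|yx|->] := ltgtP x y; first exact: H.
    by rewrite distrC [leRHS]distrC; exact: H.
  by rewrite !subrr.
have dat z : z \in `]x, y[ -> is_derive z 1 (@atan R) (1 + z ^+ 2)^-1.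
  by move=> _; exact: is_derive1_atan.
have cat : {within `[x, y], continuous (@atan R)}.
  by apply: continuous_subspaceT => z; exact: continuous_atan.
have [c _ E] := MVT xy dat cat.
rewrite distrC [leRHS]distrC E normrM ler_piMl//.
have h : 1 <= 1 + c ^+ 2 by rewrite lerDl sqr_ge0.
rewrite ger0_norm ?invr_ge0; last by apply: le_trans h.
by rewrite invf_le1//; apply: lt_le_trans h.
Qed.

(** In polar form the quotient is an affine function of a tangent of the angle, so
    the angles are images of slopes under countably many Lipschitz maps built on
    the arctangent. *)
Lemma negligible_slope_angle (R : realType) (a1 b1 a2 b2 : R) (N : set R) :
  a1 * b2 - b1 * a2 != 0 -> lebesgue_measure.-negligible N ->
  lebesgue_measure.-negligible [set t : R | cos t * a1 - sin t * b1 != 0 /\ N (- (cos t * a2 - sin t * b2) / (cos t * a1 - sin t * b1))].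
Proof.
move=> det0 N0.
have ab0 : (a1, b1) != (0, 0).
  by apply/eqP => -[a10 b10]; move: det0; rewrite a10 b10 !mul0r subrr eqxx.
have [rho [al [rho0 a1E b1E]]] := polar_form ab0.
pose be1 := a2 * cos al + b2 * sin al; pose be2 := a2 * sin al - b2 * cos al.
have be20 : be2 != 0.
  apply: contra det0 => /eqP be20; rewrite a1E b1E.
  by rewrite -[X in _ == X](mulr0 (- rho)) -be20 /be2; apply/eqP; ring.
pose g (k : int) (x : R) := atan (- (rho * x + be1) / be2) - al + k%:~R * pi.
have : lebesgue_measure.-negligible (\bigcup_(k : int) (g k @` N)).
  apply: negligible_bigcup_count => k.
  apply: (@negligible_lipschitz_image _ _ (rho / `|be2|)) => // x y.
  rewrite /g; have -> : forall p q r s : R, p - r + s - (q - r + s) = p - q by move=> *; ring.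
  apply: (le_trans (atan_lipschitz _ _)).
  have -> : - (rho * x + be1) / be2 - - (rho * y + be1) / be2 = - (rho / be2 * (x - y)) by field.
  by rewrite normrN !normrM normfV (gtr0_norm rho0).
apply: negligibleS => t /= [A0 Nx].
have [k /andP[k1 k2] [c c0 [cu su]]] := shift_intpi (t + al).
exists k => //; exists (- (cos t * a2 - sin t * b2) / (cos t * a1 - sin t * b1)) => //.
set u := t + al in k1 k2 cu su; set v := u - k%:~R * pi in k1 k2 cu su.
have AE : cos t * a1 - sin t * b1 = rho * cos u by rewrite a1E b1E /u cosD; ring.
have tE : t = u - al by rewrite /u addrK.
have BE : cos t * a2 - sin t * b2 = be1 * cos u + be2 * sin u.
  by rewrite {1 2}tE cosB sinB /be1 /be2; ring.
have cv0 : cos v != 0.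
  by move: A0; rewrite AE cu mulf_eq0 negb_or => /andP[_]; rewrite mulf_eq0 negb_or => /andP[].
have v2 : v < pi / 2.
  rewrite lt_neqAle k2 andbT; apply: contra cv0 => /eqP ->.
  by rewrite cos_pihalf.
rewrite AE BE [RHS](_ : t = v - al + k%:~R * pi); last by rewrite /v /u; ring.
rewrite /g; congr (_ - _ + _).
rewrite -[RHS]tanK; last by rewrite in_itv/= k1.
congr atan; rewrite /tan cu su; field.
by rewrite be20 cv0 c0 gt_eqF.
Qed.

(** * Inhomogeneous approximation for almost every rotation *)

Import ComplexField.

Lemma mulrz_complex (R : realType) (z : R[i]) (m : int) : 
  z *~ m = Complex (complex.Re z * m%:~R) (complex.Im z * m%:~R).
Proof.
have nat (n : nat) : z *+ n = Complex (complex.Re z * n%:R) (complex.Im z * n%:R).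
  case: z => x y; elim: n => [|n IH]; first by rewrite /= !mulr0.
  rewrite mulrSr IH /= -!natr1 !mulrDr !mulr1; by [].
case: m => n; first exact: nat.
rewrite NegzE !mulrNz -pmulrn nat; apply/eqP; rewrite eq_complex/=.
by rewrite -!pmulrn !mulrN !eqxx.
Qed.

(** The determinant of two plane vectors, that is the oriented area of the
    parallelogram on them. *)
Definition area (R : realType) (z w : R[i]) : R :=
  complex.Re z * complex.Im w - complex.Im z * complex.Re w.

Lemma area_le (R : realType) (z w : R[i]) :
  `|area z w| <= Normc.normc z * Normc.normc w.
Proof.
case: z w => [a b] [c d]; rewrite /area /= -sqrtrM ?addr_ge0 ?sqr_ge0//.
rewrite -sqrtr_sqr ler_wsqrtr//.
have -> : (a ^+ 2 + b ^+ 2) * (c ^+ 2 + d ^+ 2) =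
    (a * d - b * c) ^+ 2 + (a * c + b * d) ^+ 2 by ring.
by rewrite lerDl sqr_ge0.
Qed.

Lemma normc_scale (R : realType) (x : R) (z : R[i]) :
  Normc.normc (x%:C%C * z) = `|x| * Normc.normc z.
Proof. by rewrite Normc.normcM /= expr0n addr0 sqrtr_sqr. Qed.

Lemma Re_le_normc (R : realType) (z : R[i]) : `|complex.Re z| <= Normc.normc z.
Proof.
by case: z => a b /=; rewrite -sqrtr_sqr ler_wsqrtr// lerDl sqr_ge0.
Qed.

Lemma normc_ge0 (R : realType) (z : R[i]) : 0 <= Normc.normc z.
Proof. by case: z => a b /=; exact: sqrtr_ge0. Qed.

Lemma normc_rotC (R : realType) (t : R) (z : R[i]) :
  Normc.normc (rotC t z) = Normc.normc z.
Proof. by rewrite rotCE Normc.normcM /= cos2Dsin2 sqrtr1 mul1r. Qed.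

Lemma area_lincomb (R : realType) (a b : R) (z w : R[i]) :
  area z (a%:C%C * z + b%:C%C * w) = b * area z w.
Proof. by case: z w => [x y] [x' y']; rewrite /area /=; ring. Qed.

Lemma Re_rotC_lincomb (R : realType) (t a b : R) (z w : R[i]) :
  complex.Re (rotC t (a%:C%C * z + b%:C%C * w)) =
  a * complex.Re (rotC t z) + b * complex.Re (rotC t w).
Proof. by case: z w => [x y] [x' y']; rewrite /rotC /=; ring. Qed.

Lemma approx_fun_scale (R : realType) (phi : R -> R) (k : R) : 1 <= k ->
  approx_fun phi -> approx_fun (fun t => phi (k * t) / k).
Proof.
move=> k1 [p0 pd pv]; have k0 : 0 < k by lra.
have kk : 0 < k ^+ 2 by rewrite exprn_gt0.
have tE t : t * (phi (k * t) / k) = (k * t) * phi (k * t) / k ^+ 2.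
  by field; rewrite gt_eqF.
split=> [t t0|s t s1 st|t0 t01 B].
- by rewrite divr_gt0// p0// mulr_ge0// ltW.
- rewrite !tE ler_pM2r ?invr_gt0//; apply: pd; last by rewrite ler_pM2l.
  by nra.
- have kt : 1 <= k * t0 by nra.
  have [N hN] := pv _ kt (B * k ^+ 2); exists N.
  rewrite -(ltr_pM2r kk); apply: (lt_le_trans hN); rewrite mulr_suml.
  apply: ler_sum => n _; rewrite tE divfK ?gt_eqF//.
  by rewrite !mulrA.
Qed.

(** In the basis [w1], [w2] the statement is that of [slope_khinchin] for the slope
    [x = - B / A], where [A] and [B] are the real parts of the rotated basis. The
    length of the vector is at most a constant times [n + s2], a constant which
    depends on [x]: the null sets of slopes are therefore taken for all the
    functions [phi (k * t) / k] at once. *)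
Theorem rotated_khinchin (R : realType) (phi : R -> R) (w1 w2 s : R[i]) :
  approx_fun phi -> area w1 w2 != 0 ->
  lebesgue_measure.-negligible [set t : R | ~ forall M : R, exists m n : int,
    M <= Normc.normc (s + w1 *~ m + w2 *~ n) /\
    `|complex.Re (rotC t (s + w1 *~ m + w2 *~ n))| < phi (Normc.normc (s + w1 *~ m + w2 *~ n))].
Proof.
move=> phiP w0; have phi_gt0 := approx_gt0 phiP; have phi_decr := approx_decr phiP.
have phi_ni := nonincreasing_of_mul phi_gt0 phi_decr.
pose s1 := area s w2 / area w1 w2; pose s2 := area w1 s / area w1 w2.
have vE m n : s + w1 *~ m + w2 *~ n =
    (m%:~R + s1)%:C%C * w1 + (n%:~R + s2)%:C%C * w2.
  rewrite !mulrz_complex; apply/eqP; rewrite eq_complex; move: w0.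
  rewrite /s1 /s2 /area; clear; case: w1 w2 s => [a1 b1] [a2 b2] [c d] /= w0.
  by apply/andP; split; apply/eqP; field.
pose A t := cos t * complex.Re w1 - sin t * complex.Im w1.
pose B t := cos t * complex.Re w2 - sin t * complex.Im w2.
pose bad (k : nat) : set R := [set x | ~ forall N : nat, exists m n : int, N%:R <= n%:~R + s2 /\
      `|(n%:~R + s2) * x - (m%:~R + s1)| < phi (k.+1%:R * (n%:~R + s2)) / k.+1%:R].
have bad0 : lebesgue_measure.-negligible (\bigcup_k bad k).
  apply: negligible_bigcup => k; have k1 : 1 <= k.+1%:R :> R by rewrite ler1n.
  exact: (slope_khinchin s1 s2 (approx_fun_scale k1 phiP)).
have w1n0 : (complex.Re w1, complex.Im w1) != (0, 0).
  by apply/eqP => -[x0 y0]; move: w0; rewrite /area x0 y0 !mul0r subrr eqxx.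
have := negligibleU (negligible_orthogonal w1n0) (negligible_slope_angle w0 bad0).
apply: negligibleS => t /= nP; apply: contrapT => /not_orP[/eqP A0 /not_andP nbad].
apply: nP => M.
rewrite -/(A t) in A0; have {}nbad : ~ (\bigcup_k bad k) (- B t / A t) by case: nbad.
have rho1 : 0 < Normc.normc w1.
  have := area_le w1 w2; have := normc_ge0 w1; rewrite le_eqVlt => /orP[/eqP <-|//].
  by rewrite mul0r normr_le0 (negbTE w0).
have rho2 := normc_ge0 w2.
set x := - B t / A t in nbad *.
pose K := Normc.normc w1 * (`|x| + 1) + Normc.normc w2.
pose k := Num.bound K; have Kk : K < k.+1%:R.
  apply: lt_trans (_ : k%:R < _); last by rewrite ltr_nat.
  by apply: archi_boundP; rewrite addr_ge0// mulr_ge0 ?(ltW rho1)// addr_ge0.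
have area0 : 0 < `|area w1 w2| by rewrite normr_gt0.
pose M' := Num.max 1 M.
(* Beyond C, n + s2 dominates the error and forces the length above M'. *)
pose C := 1 + phi 1 + M' * Normc.normc w1 / `|area w1 w2|.
have M'1 : 1 <= M' by rewrite le_max lexx.
have M'M : M <= M' by rewrite le_max lexx orbT.
have p1 : 0 < phi 1 by exact: phi_gt0.
have C0 : 0 <= M' * Normc.normc w1 / `|area w1 w2|.
  by rewrite divr_ge0 ?mulr_ge0 ?(ltW rho1)//; lra.
have : ~ bad k x by move=> bx; apply: nbad; exists k.
move=> /contrapT/(_ (Num.bound C)) [m [n [nC close]]].
have {}nC : C < n%:~R + s2.
  by apply: lt_le_trans nC; apply: archi_boundP; rewrite /C; lra.
exists m, n; rewrite vE; set a := m%:~R + s1 in close *; set b := n%:~R + s2 in nC close *.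
set v := _ + _.
have b0 : 0 < b by rewrite /C in nC; lra.
have k1 : 1 <= k.+1%:R :> R by rewrite ler1n.
have kb : 1 <= k.+1%:R * b by rewrite /C in nC; nra.
have ab : `|a| <= b * (`|x| + 1).
  have : `|a| <= `|b * x| + `|b * x - a|.
    by have := ler_normB (b * x) (b * x - a); rewrite opprB addrC subrK.
  have : phi (k.+1%:R * b) / k.+1%:R <= phi 1.
    rewrite ler_pdivrMr ?ltr0n//.
    by apply: (le_trans (phi_ni _ _ (lexx 1) kb)); rewrite ler_peMr// ltW.
  rewrite normrM (gtr0_norm b0); rewrite /C in nC; move: close C0 nC. set c1 := _ / _; set c2 := _ / _; lra.
have v_le : Normc.normc v <= k.+1%:R * b.
  apply: (le_trans (le_normcD _ _)); rewrite !normc_scale (gtr0_norm b0).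
  have h : `|a| * Normc.normc w1 <= b * (`|x| + 1) * Normc.normc w1 by rewrite ler_pM2r.
  have h2 : K * b <= k.+1%:R * b by rewrite ler_pM2r// ltW.
  by rewrite /K in h2; lra.
have v_ge : M' <= Normc.normc v.
  have : `|area w1 v| <= Normc.normc w1 * Normc.normc v by exact: area_le.
  rewrite /v area_lincomb.
  rewrite normrM (gtr0_norm b0) mulrC -ler_pdivrMl// => h.
  apply: le_trans h; rewrite ler_pdivlMl// -[leRHS]mulrC -ler_pdivrMr//.
  by rewrite [Normc.normc w1 * _]mulrC /C in nC *; lra.
split; first exact: le_trans v_ge.
apply: (@lt_le_trans _ _ (phi (k.+1%:R * b))); last first.
  by apply: phi_ni v_le; exact: le_trans v_ge.
rewrite -[X in `|X| < _]/(complex.Re (rotC t v)).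
have -> : complex.Re (rotC t v) = - (A t * (b * x - a)).
  rewrite /v Re_rotC_lincomb -[complex.Re (rotC t w1)]/(A t).
  by rewrite -[complex.Re (rotC t w2)]/(B t) /x; field.
have Ak : `|A t| <= k.+1%:R.
  have -> : A t = complex.Re (rotC t w1) by [].
  apply: (le_trans (Re_le_normc _)); rewrite normc_rotC.
  apply: le_trans (ltW Kk); rewrite /K; have := normr_ge0 x; nra.
rewrite normrN normrM.
have A0' : 0 < `|A t| by rewrite normr_gt0.
apply: (@lt_le_trans _ _ (`|A t| * (phi (k.+1%:R * b) / k.+1%:R))).
  by rewrite ltr_pM2l.
have phi0 : 0 <= phi (k.+1%:R * b) by apply: ltW; apply: phi_gt0; apply: le_trans kb.
rewrite mulrCA; apply: (ler_piMr phi0).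
by rewrite ler_pdivrMr ?ltr0n// mul1r.
Qed.

(** * Plane lattices *)

Local Open Scope complex_scope.

Lemma finite_set_bounded (T : eqType) (R : realType) (W : set T) (f : T -> R) :
  finite_set W -> exists M : R, forall x, W x -> f x <= M.
Proof.
move=> /finite_seqP[s ->]; elim: s => [|y s [M IH]]; first by exists 0.
exists (Num.max (f y) M) => x /=; rewrite inE => /orP[/eqP ->|xs].
  by rewrite le_max lexx.
by rewrite le_max IH ?orbT.
Qed.

Lemma finite_set_min (R : realType) (W : set R) (x0 : R) :
  finite_set W -> W x0 -> exists2 x, W x & forall y, W y -> x <= y.
Proof.
move=> /finite_seqP[s ->]; elim: s x0 => [//|y s IH] x0 _.
case: s IH => [_|y' s IH].
  by exists y => /=; [rewrite inE eqxx|move=> z; rewrite inE => /eqP ->].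
have [|x xs xmin] := IH y'; first by rewrite /= inE eqxx.
exists (Num.min y x) => /=.
  by case: leP => _; rewrite inE ?eqxx//; apply/orP; right; exact: xs.
move=> z; rewrite inE => /orP[/eqP ->|/xmin xz]; first by rewrite ge_min lexx.
by rewrite ge_min xz orbT.
Qed.

Definition lattice_span (R : realType) (w1 w2 : R[i]) : set R[i] :=
  [set x | exists m n : int, x = w1 *~ m + w2 *~ n].

Section lattice_span.
Variables (R : realType) (w1 w2 : R[i]).
Hypothesis w12 : area w1 w2 != 0.
Local Notation L := (lattice_span w1 w2).

Lemma lattice_span0 : L 0.
Proof. by exists 0, 0; rewrite !mulr0z addr0. Qed.

Lemma lattice_spanD x y : L x -> L y -> L (x + y).
Proof.
move=> [m [n ->]] [m' [n' ->]]; exists (m + m'), (n + n').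
by rewrite !mulrzDr addrACA.
Qed.

Lemma lattice_spanN x : L x -> L (- x).
Proof. by move=> [m [n ->]]; exists (- m), (- n); rewrite !mulrNz opprD. Qed.

Lemma lattice_spanB x y : L x -> L y -> L (x - y).
Proof. by move=> Lx Ly; apply: lattice_spanD => //; exact: lattice_spanN. Qed.

Lemma lattice_spanMz x k : L x -> L (x *~ k).
Proof. by move=> [m [n ->]]; exists (m * k), (n * k); rewrite mulrzDl !mulrzA. Qed.

Lemma areaDl (x y z : R[i]) : area (x + y) z = area x z + area y z.
Proof. by rewrite /area !raddfD/=; ring. Qed.
Lemma areaDr (x y z : R[i]) : area x (y + z) = area x y + area x z.
Proof. by rewrite /area !raddfD/=; ring. Qed.
Lemma areaMzl (x y : R[i]) (m : int) : area (x *~ m) y = m%:~R * area x y.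
Proof. by rewrite mulrz_complex /area /=; ring. Qed.
Lemma areaMzr (x y : R[i]) (m : int) : area x (y *~ m) = m%:~R * area x y.
Proof. by rewrite mulrz_complex /area /=; ring. Qed.
Lemma areaxx (x : R[i]) : area x x = 0.
Proof. by rewrite /area; ring. Qed.
Lemma areaC (x y : R[i]) : area y x = - area x y.
Proof. by rewrite /area; ring. Qed.

Lemma area_cramer (x y d : R[i]) :
  (area x y)%:C * d = (area d y)%:C * x + (area x d)%:C * y.
Proof.
by case: x y d => [a b] [c e] [f g]; apply/eqP; rewrite eq_complex /area /=;
  apply/andP; split; apply/eqP; ring.
Qed.

Lemma area_lattice x y : L x -> L y -> exists k : int, area x y = k%:~R * area w1 w2.
Proof.
move=> [m [n ->]] [m' [n' ->]]; exists (m * n' - n * m').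
rewrite !areaDl !areaDr !areaMzl !areaMzr !areaxx (areaC w1 w2) intrB !intrM; ring.
Qed.

(** Cramer's rule over the integers. *)
Lemma lattice_cramer x y d (N k1 k2 : int) : L x -> L y ->
  area x y = N%:~R * area w1 w2 -> area x d = k1%:~R * area w1 w2 ->
  area y d = k2%:~R * area w1 w2 -> L (d *~ N).
Proof.
move=> Lx Ly xy xd yd.
suff -> : d *~ N = x *~ (- k2) + y *~ k1.
  by apply: lattice_spanD; exact: lattice_spanMz.
have := area_cramer x y d; rewrite (areaC y d) xy xd yd.
have CM (a b : R) (z : R[i]) : (a * b)%:C * z = b%:C * (a%:C * z).
  by rewrite mulrA; congr (_ * _); rewrite -rmorphM mulrC.
have C0 : (area w1 w2)%:C != 0 by rewrite eq_complex /= eqxx andbT.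
have CZ (k : int) (z : R[i]) : (k%:~R)%:C * z = z *~ k by rewrite rmorph_int mulrzl.
have CNZ (k : int) (z : R[i]) : (- (k%:~R * area w1 w2))%:C * z =
  (area w1 w2)%:C * (z *~ (- k)).
  by rewrite -mulNr -mulrNz CM CZ.
by rewrite CNZ !CM !CZ -mulrDr => /(mulfI C0).
Qed.

(** By Cramer's rule the coordinates of a lattice vector are bounded by its
    length. *)
Lemma finite_lattice_ball (d : R[i]) (B : R) :
  finite_set [set x | L (x - d) /\ Normc.normc x <= B].
Proof.
pose K := (Num.max B 0 + Normc.normc d) * (Normc.normc w1 + Normc.normc w2) / `|area w1 w2|.
have a0 : 0 < `|area w1 w2| by rewrite normr_gt0.
have K0 : 0 <= K.
  by rewrite divr_ge0 ?mulr_ge0 ?addr_ge0 ?normc_ge0// le_max lexx orbT.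
pose k := Num.bound K; have Kk : K < k%:R by exact: archi_boundP.
pose f (ij : 'I_(k + k) * 'I_(k + k)) : R[i] :=
  d + w1 *~ (ij.1%:Z - k%:Z) + w2 *~ (ij.2%:Z - k%:Z).
apply: (@sub_finite_set _ _ (f @` setT)); last exact/finite_image/finite_finset.
move=> x [[m [n xd]] xB].
have nd : Normc.normc (x - d) <= Num.max B 0 + Normc.normc d.
  apply: (le_trans (le_normcD _ _)); rewrite normcN lerD2r.
  by rewrite (le_trans xB)// le_max lexx.
have small (j : int) : `|j%:~R| * `|area w1 w2| <=
    (Num.max B 0 + Normc.normc d) * (Normc.normc w1 + Normc.normc w2) ->
    exists i : 'I_(k + k), j = i%:Z - k%:Z.
  rewrite -ler_pdivlMr// => jK; have : `|j%:~R| < k%:R :> R by apply: le_lt_trans Kk.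
  rewrite -intr_norm -[k%:R]/(k%:Z%:~R) ltr_int => jk.
  have ik : (absz (j + k%:Z)%R < k + k)%N by lia.
  by exists (Ordinal ik) => /=; lia.
have [|i iE] := small m.
  have : `|area (x - d) w2| <= Normc.normc (x - d) * Normc.normc w2 by exact: area_le.
  rewrite xd areaDl !areaMzl areaxx mulr0 addr0 normrM -xd => /le_trans; apply.
  by apply: ler_pM; rewrite ?normc_ge0// lerDr normc_ge0.
have [|j jE] := small n.
  have : `|area w1 (x - d)| <= Normc.normc w1 * Normc.normc (x - d) by exact: area_le.
  rewrite xd areaDr !areaMzr areaxx mulr0 add0r normrM -xd => /le_trans; apply.
  by rewrite mulrC; apply: ler_pM; rewrite ?normc_ge0// lerDl normc_ge0.
by exists (i, j) => //; rewrite /f /= -iE -jE -addrA -xd addrC subrK.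
Qed.
End lattice_span.

(** * Good saddle connections from a fixed puncture *)

Lemma Re_rotC_scale (R : realType) (t c : R) (v : R[i]) :
  complex.Re (rotC t (c%:C * v)) = c * complex.Re (rotC t v).
Proof. by case: v => a b; rewrite /rotC /=; ring. Qed.

Lemma area_eq0 (R : realType) (x y : R[i]) : x != 0 -> area x y = 0 ->
  exists c : R, y = c%:C * x.
Proof.
case: x y => [a b] [e f] x0; rewrite /area /= => /eqP; rewrite subr_eq0 => /eqP af.
have s0 : a ^+ 2 + b ^+ 2 != 0.
  rewrite paddr_eq0 ?sqr_ge0// !sqrf_eq0; apply: contra x0 => /andP[a0 b0].
  by rewrite eq_complex /= a0 b0.
exists ((a * e + b * f) / (a ^+ 2 + b ^+ 2)); apply/eqP; rewrite eq_complex /= !mul0r subr0 addr0.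
rewrite !(mulrAC _ (_^-1)).
apply/andP; split; apply/eqP; apply: (mulIf s0); rewrite divfK//.
  have -> : (a * e + b * f) * a = a * a * e + b * (a * f) by ring.
  by rewrite af; ring.
have -> : (a * e + b * f) * b = a * (b * e) + b * b * f by ring.
by rewrite -af; ring.
Qed.

Section saddle.
Variables (R : realType) (r : nat) (w1 w2 : R[i]) (z : 'I_r -> R[i]) (t : R) (phi : R -> R).
Hypothesis w12 : area w1 w2 != 0.
Hypothesis phiP : approx_fun phi.
Local Notation L := (lattice_span w1 w2).
Local Notation normc := Normc.normc.

Hypothesis z_inj : forall i j, L (z i - z j) -> i = j.

Definition good_vector (v : R[i]) := `|complex.Re (rotC t v)| < phi (normc v).

(** The holonomies of the saddle connections from puncture [j] to puncture [i], in
    terms of a choice [z] of lifts of the punctures. *)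
Definition unobstructed (j i : 'I_r) (v : R[i]) :=
  [/\ v != 0, L (z j + v - z i) &
      forall s : R, 0 < s < 1 -> forall k, ~ L (z j + s%:C * v - z k)].

Hypothesis irr : forall i j x, L (x - (z i - z j)) -> x != 0 -> complex.Re (rotC t x) != 0.
Hypothesis approx_diff : forall (i j : 'I_r) (M : R), exists m n : int,
  M <= normc (z i - z j + w1 *~ m + w2 *~ n) /\ good_vector (z i - z j + w1 *~ m + w2 *~ n).
Hypothesis approx_sub : forall (b : bool) (N : int) (M : R), N != 0 -> exists m n : int,
  M <= normc ((if b then w1 else w2) + w1 *~ N *~ m + w2 *~ N *~ n) /\
  good_vector ((if b then w1 else w2) + w1 *~ N *~ m + w2 *~ N *~ n).

Let hit_vector l i w : L (z l + w - z i) -> L (w - (z i - z l)).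
Proof. by have -> : w - (z i - z l) = z l + w - z i by ring. Qed.

(** Only finitely many translates of punctures lie within the length of [v]. *)
Lemma first_hit (l q : 'I_r) (v : R[i]) : v != 0 -> L (z l + v - z q) ->
  exists2 a : R, 0 < a <= 1 & exists i, unobstructed l i (a%:C * v).
Proof.
move=> v0 lq.
have nv0 : 0 < normc v.
  have := normc_ge0 v; rewrite le_eqVlt => /orP[/eqP/esym/Normc.eq0_normc v0'|//].
  by rewrite v0' eqxx in v0.
pose H : set R := [set a | 0 < a <= 1 /\ exists k, L (z l + a%:C * v - z k)].
have finH : finite_set H.
  pose W := \bigcup_(k : 'I_r) [set x | L (x - (z k - z l)) /\ normc x <= normc v].
  have finW : finite_set W.
    by apply: bigcup_finite => [|k _]; [exact: finite_finset|exact: finite_lattice_ball].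
  apply: sub_finite_set (finite_image (fun x => normc x / normc v) finW).
  move=> a [/andP[a0 a1] [k Lk]]; exists (a%:C * v); last first.
    by rewrite normc_scale gtr0_norm// mulfK// gt_eqF.
  exists k => //; split; last by rewrite normc_scale gtr0_norm// ler_piMl// ltW.
  exact: hit_vector.
have H1 : H 1 by split; [rewrite ltr01 lexx|exists q; rewrite mul1r].
have [a [/andP[a0 a1] [i Li]] amin] := finite_set_min finH H1.
exists a; first by rewrite a0 a1.
exists i; split => //.
  by rewrite mulf_neq0// eq_complex /= eqxx andbT gt_eqF.
move=> s /andP[s0 s1] k Lk.
have : a <= s * a.
  apply: amin; split; last by exists k; rewrite rmorphM -mulrA.
  by rewrite mulr_gt0//= (le_trans _ a1)// ler_piMl// ltW.
by rewrite leNgt gtr_pMl// s1.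
Qed.

Let phi_gt0 := approx_gt0 phiP.
Let phi_decr := approx_decr phiP.

(** Multiplying a vector by [a <= 1] multiplies its real part by [a], but cannot
    decrease the value of [phi] at its length. *)
Lemma good_shorten (a : R) (v : R[i]) : 0 < a <= 1 -> 1 <= normc (a%:C * v) ->
  good_vector v -> good_vector (a%:C * v).
Proof.
move=> /andP[a0 a1]; rewrite /good_vector Re_rotC_scale normc_scale normrM (gtr0_norm a0) => av gv.
have v1 : 1 <= normc v by have := normc_ge0 v; nra.
apply: (@lt_le_trans _ _ (a * phi (normc v))); first by rewrite ltr_pM2l.
have h := phi_decr av (_ : a * normc v <= normc v).
have {}h : normc v * phi (normc v) <= a * normc v * phi (a * normc v).
  by apply: h; rewrite ler_piMl//; lra.
have p0 : 0 < phi (a * normc v) by apply: phi_gt0; lra.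
have pv : phi (normc v) <= a * phi (a * normc v).
  have v0 : 0 < normc v by lra.
  by rewrite -(ler_pM2l v0); lra.
apply: (@le_trans _ _ (a * phi (a * normc v))); last by rewrite ler_piMl// ltW.
rewrite ler_pM2l//; apply: (le_trans pv).
by rewrite ler_piMl// ltW.
Qed.

(** If [w = a * v] is fixed, the ratio of the real part to the length is the same
    for [v] and [w], hence bounded below, whereas for a good [v] it is at most
    [phi 1 / normc v ^ 2]. *)
Lemma good_avoid (W : set R[i]) : finite_set W ->
  (forall w, W w -> complex.Re (rotC t w) != 0) ->
  exists M : R, forall v (a : R), 0 < a <= 1 -> M <= normc v -> good_vector v ->
    ~ W (a%:C * v).
Proof.
move=> finW W0.
have [M MP] := finite_set_bounded (fun w => normc w * phi 1 / `|complex.Re (rotC t w)|) finW.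
exists (Num.max 1 M) => v a /andP[a0 a1]; rewrite ge_max => /andP[v1 Mv] gv Wav.
have := MP _ Wav; have := W0 _ Wav.
rewrite Re_rotC_scale normc_scale normrM (gtr0_norm a0) mulf_eq0 negb_or => /andP[_ R0].
have R0' : 0 < `|complex.Re (rotC t v)| by rewrite normr_gt0.
rewrite ler_pdivrMr ?mulr_gt0// => h.
have h2 := phi_decr (lexx 1) v1; rewrite mul1r in h2.
have h3 : normc v * `|complex.Re (rotC t v)| < phi 1.
  by apply: lt_le_trans h2; rewrite ltr_pM2l// (lt_le_trans ltr01).
have h4 : a * (normc v * phi 1) <= a * (M * `|complex.Re (rotC t v)|) by lra.
rewrite ler_pM2l// in h4.
have h5 : M * `|complex.Re (rotC t v)| <= normc v * `|complex.Re (rotC t v)|.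
  by rewrite ler_pM2r.
have p1 : 0 < phi 1 by exact: phi_gt0.
nra.
Qed.

Definition linked (j i : 'I_r) : set R[i] := [set v | unobstructed j i v /\ good_vector v].

(** The vectors to avoid are those of the finitely many good saddle connections
    from [l] to punctures outside [D], and those of length at most 1, to which
    [good_shorten] does not apply. *)
Lemma first_good_hit (l : 'I_r) (D : set 'I_r) :
  (forall i, ~ D i -> finite_set (linked l i)) ->
  exists M : R, forall v q, L (z l + v - z q) -> M <= normc v -> good_vector v ->
    exists2 a : R, 0 < a <= 1 & exists2 i, D i & unobstructed l i (a%:C * v).
Proof.
move=> finD.
pose W := \bigcup_(i : 'I_r) ([set w | ~ D i /\ linked l i w] `|`
  [set w | w != 0 /\ L (w - (z i - z l)) /\ normc w <= 1]).
have finW : finite_set W.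
  apply: bigcup_finite => [|i _]; first exact: finite_finset.
  rewrite finite_setU; split.
    have [Di|nDi] := pselect (D i); last by apply: sub_finite_set (finD _ nDi) => w [].
    by apply: (@sub_finite_set _ _ set0) => // w [].
  by apply: sub_finite_set (finite_lattice_ball w12 (z i - z l) 1) => w [_].
have W0 w : W w -> complex.Re (rotC t w) != 0.
  by move=> [i _ [[_ [[w0 /hit_vector Lw _] _]]|[w0 [Lw _]]]]; exact: irr Lw w0.
have [M MP] := good_avoid finW W0.
exists (Num.max 1 M) => v q Lv; rewrite ge_max => /andP[v1 Mv] gv.
have v0 : v != 0.
  by apply/eqP => v0; move: v1; rewrite v0 Normc.normc0 ler10.
have [a a01 [i ui]] := first_hit v0 Lv.
exists a => //; exists i => //; apply: contrapT => nDi.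
apply: (MP v a a01 Mv gv); exists i => //.
have [w0 Lw _] := ui.
have [w1'|/ltW w1'] := leP (normc (a%:C * v)) 1; first by right; split => //; split => //; exact: hit_vector.
by left; split => //; split => //; exact: good_shorten.
Qed.

Lemma exists_linked (l : 'I_r) : exists i, infinite_set (linked l i).
Proof.
apply: contrapT => nex.
have [|M MP] := @first_good_hit l set0.
  by move=> i _; apply: contrapT => inf; apply: nex; exists i.
have [m [n [Mv gv]]] := approx_diff l l M.
have [|a _ [i []]] := MP _ l _ Mv gv.
by exists m, n; ring.
Qed.

(** If the first puncture met is [l] itself, at [a * v], the whole line is a closed
    geodesic through [l] and no other puncture. Reducing the position [1 / a] of [q]
    modulo 1 would show [q] on the first turn. *)
Lemma linked_not_only_loops (l q : 'I_r) : q != l ->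
  exists2 i, i != l & infinite_set (linked l i).
Proof.
move=> ql; apply: contrapT => nex.
have [|M MP] := @first_good_hit l [set l].
  by move=> i /eqP il; apply: contrapT => inf; apply: nex; exists i.
have [m [n [Mv gv]]] := approx_diff q l M.
set v := _ + _ in Mv gv.
have Lv : L (z l + v - z q).
  by exists m, n; rewrite /v; ring.
have [a /andP[a0 a1] [_ -> [w0 Lw clear]]] := MP v q Lv Mv gv.
rewrite addrAC subrr add0r in Lw.
pose k := Num.floor a^-1.
have /andP[k1 k2] := floor_itv a^-1; rewrite -/k intrD in k1 k2.
pose s := a^-1 - k%:~R.
have sE : s%:C * (a%:C * v) = v - a%:C * v *~ k.
  rewrite /s rmorphB rmorph_int mulrBl mulrzl; congr (_ - _).
  by rewrite mulrA -rmorphM mulVf ?gt_eqF// mul1r.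
have Ls : L (z l + s%:C * (a%:C * v) - z q).
  have -> : z l + s%:C * (a%:C * v) - z q = (z l + v - z q) - a%:C * v *~ k.
    by rewrite sE; ring.
  by apply: lattice_spanB => //; apply: lattice_spanMz.
have : 0 <= s by rewrite /s; lra.
rewrite le_eqVlt => /orP[/eqP s0|s0].
  move: Ls; rewrite -s0 mul0r addr0 => /z_inj lq.
  by rewrite lq eqxx in ql.
by apply: (clear s _ q) => //; rewrite s0 /s; lra.
Qed.

(** Otherwise long good vectors of [L] have integral area with [d = z m - z l], up to
    the covolume. The cosets [w1 + N * L] and [w2 + N * L] carry this integrality over
    to the basis itself, and [d] would be in the lattice. *)
Lemma linked_not_only (l m : 'I_r) : l != m ->
  exists2 i, i != m & infinite_set (linked l i).
Proof.
move=> lm; apply: contrapT => nex.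
have [|M MP] := @first_good_hit l [set m].
  by move=> i /eqP im; apply: contrapT => inf; apply: nex; exists i.
pose d := z m - z l; pose D := area w1 w2.
(* The multiple a * v is d up to a lattice vector, and the area of v with a * v
   vanishes. *)
have integral v : L v -> M <= normc v -> good_vector v -> exists k : int, area v d = k%:~R * D.
  move=> Lv Mv gv.
  have [|a _ [_ -> [_ La _]]] := MP v l _ Mv gv; first by rewrite addrAC subrr add0r.
  have Ld : L (a%:C * v - d) by exact: hit_vector.
  have [k kE] := area_lattice Lv Ld; exists (- k).
  have -> : d = a%:C * v - (a%:C * v - d) by rewrite opprB addrC subrK.
  move: kE; rewrite -/D; set u := a%:C * v - d => kE.
  have -> : area v (a%:C * v - u) = - area v u.
    rewrite areaDr; have -> : area v (a%:C * v) = 0 by case: (v) => x y; rewrite /area /=; ring.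
    by rewrite add0r /area !raddfN /=; ring.
  by rewrite kE rmorphN mulNr.
have Lz0 x y : L (z l - z l + w1 *~ x + w2 *~ y) by exists x, y; rewrite subrr add0r.
have [x1 [y1 [Mv1 gv1]]] := approx_diff l l (Num.max 1 M).
have Lv1 := Lz0 x1 y1; move: Mv1 gv1 Lv1; set v1 := _ + _ *~ y1 => Mv1 gv1 Lv1.
have {Mv1} [v11 Mv1] : 1 <= normc v1 /\ M <= normc v1 by move: Mv1; rewrite ge_max => /andP.
have v10 : v1 != 0 by apply/eqP => v0; move: v11; rewrite v0 Normc.normc0 ler10.
have irr1 : complex.Re (rotC t v1) != 0.
  by apply: (irr (i := l) (j := l)) => //; rewrite subrr subr0.
have W0 w : ([set v1] `|` [set - v1]) w -> complex.Re (rotC t w) != 0.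
  move=> [->//|->]; have -> : - v1 = (- 1)%:C * v1 by rewrite rmorphN1 mulN1r.
  by rewrite Re_rotC_scale mulN1r oppr_eq0.
have finW : finite_set ([set v1] `|` [set - v1]).
  by rewrite finite_setU; split; exact: finite_set1.
have [M2 M2P] := good_avoid finW W0.
have [x2 [y2 [Mv2 gv2]]] := approx_diff l l (Num.max (normc v1) (Num.max M M2)).
have Lv2 := Lz0 x2 y2; move: Mv2 gv2 Lv2; set v2 := _ + _ *~ y2 => Mv2 gv2 Lv2.
have {Mv2} [v12 Mv2 M2v2] : [/\ normc v1 <= normc v2, M <= normc v2 & M2 <= normc v2].
  by move: Mv2; rewrite !ge_max => /and3P[].
have [N NE] := area_lattice Lv1 Lv2.
have N0 : N != 0.
  apply/eqP => N0; rewrite N0 mul0r in NE.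
  (* Parallel vectors would make v1 or its opposite an initial piece of v2. *)
  have [c cE] := area_eq0 v10 NE.
  have nv1 : 0 < normc v1 by lra.
  have c1 : 1 <= `|c|.
    by move: v12; rewrite cE normc_scale -{1}[normc v1]mul1r ler_pM2r.
  have c0 : 0 < `|c| by lra.
  apply: (M2P v2 `|c|^-1 _ M2v2 gv2); first by rewrite invr_gt0 c0 invf_le1.
  rewrite cE mulrA -rmorphM; have [c_ge0|c_lt0] := leP 0 c.
    by left; rewrite /= ger0_norm// mulVf ?mul1r//; move: c0; rewrite ger0_norm// => /lt0r_neq0.
  by right; rewrite /= ltr0_norm// invrN mulNr mulVf ?lt_eqF// rmorphN1 mulN1r.
have [k1 k1E] := integral _ Lv1 Mv1 gv1.
have [k2 k2E] := integral _ Lv2 Mv2 gv2.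
have LNd : L (d *~ N) by exact: lattice_cramer Lv1 Lv2 NE k1E k2E.
have gen (b : bool) : exists k : int, area (if b then w1 else w2) d = k%:~R * D.
  have [x [y [Mv gv]]] := approx_sub b M N0.
  move: Mv gv; set u := if b then _ else _ => Mv gv.
  have L1 : L w1 by exists 1, 0; rewrite mulr1z mulr0z addr0.
  have L2 : L w2 by exists 0, 1; rewrite mulr1z mulr0z add0r.
  have Lu : L u by rewrite /u; case: (b).
  have [|k kE] := integral _ _ Mv gv.
    apply: lattice_spanD; last by apply: lattice_spanMz; apply: lattice_spanMz.
    by apply: lattice_spanD => //; apply: lattice_spanMz; apply: lattice_spanMz.
  have [j1 j1E] := area_lattice L1 LNd; have [j2 j2E] := area_lattice L2 LNd.
  exists (k - j1 * x - j2 * y).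
  rewrite areaMzr -/D in j1E; rewrite areaMzr -/D in j2E.
  move: kE; rewrite !areaDl !areaMzl j1E j2E !intrB !intrM; lra.
have [g1 g1E] := gen true; have [g2 g2E] := gen false.
have Ld : L (d *~ 1).
  have L1 : L w1 by exists 1, 0; rewrite mulr1z mulr0z addr0.
  have L2 : L w2 by exists 0, 1; rewrite mulr1z mulr0z add0r.
  by apply: lattice_cramer L1 L2 _ g1E g2E => //; rewrite mul1r.
by move/eqP: lm; apply; apply/esym/z_inj.
Qed.
End saddle.

(** * Saddle connections of the rotated torus *)

Lemma derive1_affine (R : realType) (a b t : R) : derive1 (fun s : R => a + s * b) t = b.
Proof.
rewrite derive1E.
have h := is_deriveD (is_derive_cst a t 1) (is_deriveM (is_derive_id t 1) (is_derive_cst b t 1)).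
rewrite (_ : (fun s : R => a + s * b) = (cst a + (id * cst b)))//.
rewrite (@derive_val _ _ _ _ _ _ _ h).
by rewrite scaler0 !add0r /GRing.scale /= mulr1.
Qed.

Lemma hol_affine (R : realType) (z v : R[i]) : hol (fun s : R => z + s%:C * v) = v.
Proof.
have int (b : R) (f : R -> R) : (forall t, f t = b) ->
    \int[lebesgue_measure]_(t in `[0, 1]) f t = b.
  move=> fb; rewrite (_ : f = cst b); last exact/funext.
  rewrite Rintegral_cst//= lebesgue_measure_itv/= lte_fin ltr01 oppr0 adde0 /=.
  by rewrite mulr1.
rewrite /hol; case: z v => [x y] [a b]; congr Complex; apply: int => t.
  rewrite (_ : (fun s => _) = (fun s => x + s * a)) ?derive1_affine//.
  by apply/funext => s /=; rewrite mul0r subr0.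
rewrite (_ : (fun s => _) = (fun s => y + s * b)) ?derive1_affine//.
by apply/funext => s /=; rewrite mul0r addr0.
Qed.

Lemma torus_proj_rotate (R : realType) (r : nat) (X : punctured_torus R r) (t : R) (x : R[i]) :
  torus_proj (rotate_torus t X) (rotC t x) = rotC t @` (torus_proj X x).
Proof.
apply/seteqP; split=> [_ [_ [l Ll <-] <-]|_ [_ [l Ll <-] <-]].
  by exists (x + l); [exists l | rewrite !rotCE mulrDr].
by exists (rotC t l); [exists l | rewrite !rotCE mulrDr].
Qed.

(** The lift of the rotated saddle connection is the rotated lift. *)
Lemma Hol_rotate (R : realType) (r : nat) (X : punctured_torus R r) (w1 w2 : R[i])
    (z : 'I_r -> R[i]) (t : R) (j i : 'I_r) (v : R[i]) :
  lattice X = lattice_span w1 w2 ->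
  (forall k, puncture X k = torus_proj X (z k)) ->
  unobstructed w1 w2 z j i v -> Hol (rotate_torus t X) j i (rotC t v).
Proof.
move=> LE zE [v0 Lv clear].
have projP x k : torus_proj X x = puncture X k <-> lattice_span w1 w2 (x - z k).
  rewrite zE /torus_proj LE; split.
    move=> E; have : lattice_coset (lattice_span w1 w2) x x.
      by exists 0; [exact: lattice_span0|rewrite addr0].
    by rewrite E => -[l Ll <-]; rewrite addrC addKr.
  move=> Lxk; apply/seteqP; split => _ [l Ll <-].
    exists (x - z k + l); first exact: lattice_spanD.
    by ring.
  exists (l - (x - z k)); first exact: lattice_spanB.
  by ring.
have rotP x k : torus_proj (rotate_torus t X) (rotC t x) = puncture (rotate_torus t X) k <->
    lattice_span w1 w2 (x - z k).
  rewrite torus_proj_rotate /=; split; first by move=> /image_rotC_inj/projP.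
  by move=> /projP ->.
pose c (s : R) := rotC t (z j) + s%:C * rotC t v.
have cE s : c s = rotC t (z j + s%:C * v).
  by rewrite /c !rotCE mulrDr mulrCA.
have c0 : torus_proj (rotate_torus t X) (c 0) = puncture (rotate_torus t X) j.
  rewrite cE; apply/rotP; rewrite mul0r addr0 subrr; exact: lattice_span0.
have c1 : torus_proj (rotate_torus t X) (c 1) = puncture (rotate_torus t X) i.
  by rewrite cE; apply/rotP; rewrite mul1r.
exists c; split => //; last by rewrite hol_affine.
split.
- exists (rotC t (z j)), (rotC t v); split => //.
  by rewrite rotCE mulf_neq0// cis_neq0.
- by exists j.
- by exists i.
- move=> s s01 [k _ /esym]; rewrite cE => /rotP; exact: clear.
Qed.

Lemma area_of_independent (R : realType) (w1 w2 : R[i]) :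
  (forall a b : R, a%:C * w1 + b%:C * w2 = 0 -> a = 0 /\ b = 0) -> area w1 w2 != 0.
Proof.
move=> indep; apply/eqP => a0.
have w10 : w1 != 0.
  apply/eqP => w10; have [] := indep 1 0; first by rewrite w10 mulr0 mul0r addr0.
  by move/eqP; rewrite oner_eq0.
have [c cE] := area_eq0 w10 a0.
have [] := indep c (-1); first by rewrite rmorphN1 mulN1r cE subrr.
by move=> _ /eqP; rewrite oppr_eq0 oner_eq0.
Qed.

Lemma card_pairs_rows (r : nat) (S : {set 'I_r * 'I_r}) (d : nat) :
  (forall l, d <= #|[set i | (l, i) \in S]%SET|)%N -> (r * d <= #|S|)%N.
Proof.
move=> row; rewrite -sum1_card.
have -> : (\sum_(p in S) 1 = \sum_(l : 'I_r) \sum_(i | (l, i) \in S) 1)%N.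
  by rewrite pair_big_dep/=; apply: eq_bigl => -[].
rewrite -[r in (r * d)%N]card_ord -sum_nat_const; apply: leq_sum => l _.
rewrite sum1dep_card; exact: row.
Qed.

Unset Implicit Arguments.

Theorem theorem1p6 (R : realType) (phi : R -> R)
  (phi_gt0 : forall t : R, 0 <= t -> 0 < phi t)
  (phi_decr : forall s t : R, 1 <= s -> s <= t -> t * phi t <= s * phi s)
  (phi_div : (\int[lebesgue_measure]_(t in `[1%R, +oo[) (phi t)%:E = +oo)%E)
  (r : nat) (r_ge1 : (1 <= r)%N) (X : punctured_torus R r) :
  {ae lebesgue_measure, forall theta : R, theta \in `[0, 2 * pi[ ->
    exists S : {set 'I_r * 'I_r},
      (2 * r - 1 <= #|S|)%N /\
      forall j i : 'I_r, (j, i) \in S ->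
        infinite_set [set v : R[i] | Hol (rotate_torus theta X) j i v /\
          `|complex.Re v| < phi (ComplexField.Normc.normc v)]}.
Proof.
have phiP : approx_fun phi.
  by split => //; exact: geometric_series_diverges.
have [w1 [w2 [indep LE]]] := latticeP X.
have w12 := area_of_independent indep.
have {}LE : lattice X = lattice_span w1 w2 by [].
have /choice[z zE] : forall k, exists x, puncture X k = torus_proj X x.
  by move=> k; have [x _ <-] := punctureP X k; exists x.
have z_inj i j : lattice_span w1 w2 (z i - z j) -> i = j.
  move=> Lij; apply: (@puncture_inj _ _ X); rewrite !zE /torus_proj LE.
  apply/seteqP; split => _ [l Ll <-].
    by exists (z i - z j + l); [exact: lattice_spanD|ring].
  by exists (l - (z i - z j)); [exact: lattice_spanB|ring].
pose nodiff (ij : 'I_r * 'I_r) : set R := [set t : R | ~ forall M : R, exists m n : int,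
  M <= Normc.normc (z ij.1 - z ij.2 + w1 *~ m + w2 *~ n) /\
  good_vector t phi (z ij.1 - z ij.2 + w1 *~ m + w2 *~ n)].
pose nosub (bN : bool * int) : set R := if bN.2 == 0 then set0 else
  [set t : R | ~ forall M : R, exists m n : int,
  M <= Normc.normc ((if bN.1 then w1 else w2) + w1 *~ bN.2 *~ m + w2 *~ bN.2 *~ n) /\
  good_vector t phi ((if bN.1 then w1 else w2) + w1 *~ bN.2 *~ m + w2 *~ bN.2 *~ n)].
pose vertical (ijmn : 'I_r * 'I_r * (int * int)) : set R :=
  let x := z ijmn.1.1 - z ijmn.1.2 + w1 *~ ijmn.2.1 + w2 *~ ijmn.2.2 in
  if x == 0 then set0 else [set t | complex.Re (rotC t x) = 0].
have null1 : lebesgue_measure.-negligible (\bigcup_ij nodiff ij).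
  by apply: negligible_bigcup_count => ij; exact: rotated_khinchin.
have null2 : lebesgue_measure.-negligible (\bigcup_bN nosub bN).
  apply: negligible_bigcup_count => -[b N]; rewrite /nosub /=.
  have [_|N0] := eqVneq N 0; first exact: negligible_set0.
  apply: rotated_khinchin => //.
  by rewrite areaMzl areaMzr !mulf_neq0// intr_eq0.
have null3 : lebesgue_measure.-negligible (\bigcup_ijmn vertical ijmn).
  apply: negligible_bigcup_count => ijmn; rewrite /vertical /=.
  case: eqVneq => [_|x0]; first exact: negligible_set0.
  apply: negligible_orthogonal; apply: contra x0.
  by rewrite xpair_eqE eq_complex.
have := negligibleU (negligibleU null1 null2) null3.
apply: negligibleS => t; apply: contra_notP => /not_orP[/not_orP[n1 n2] n3] _.
have approx_diff (i j : 'I_r) (M : R) : exists m n : int,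
    M <= Normc.normc (z i - z j + w1 *~ m + w2 *~ n) /\
    good_vector t phi (z i - z j + w1 *~ m + w2 *~ n).
  by apply: contrapT => h; apply: n1; exists (i, j) => //= /(_ M).
have approx_sub (b : bool) (N : int) (M : R) : N != 0 -> exists m n : int,
    M <= Normc.normc ((if b then w1 else w2) + w1 *~ N *~ m + w2 *~ N *~ n) /\
    good_vector t phi ((if b then w1 else w2) + w1 *~ N *~ m + w2 *~ N *~ n).
  move=> N0; apply: contrapT => h; apply: n2; exists (b, N) => //.
  by rewrite /nosub /= (negbTE N0) => /(_ M).
have irr i j x : lattice_span w1 w2 (x - (z i - z j)) -> x != 0 ->
    complex.Re (rotC t x) != 0.
  move=> [m [n xE]] x0; apply/eqP => Rx; apply: n3; exists (i, j, (m, n)) => //.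
  have {}xE : z i - z j + w1 *~ m + w2 *~ n = x by rewrite -addrA -xE; ring.
  by rewrite /vertical /= xE (negbTE x0).
pose S : {set 'I_r * 'I_r} :=
  [set ji | `[< infinite_set (linked w1 w2 z t phi ji.1 ji.2) >]]%SET.
have SP l i : infinite_set (linked w1 w2 z t phi l i) -> i \in [set i | (l, i) \in S]%SET.
  by move=> inf; rewrite finset.in_set finset.in_set; exact/asboolP.
exists S; split; last first.
  move=> j i; rewrite finset.in_set => /asboolP/= inf fin; apply: inf.
  have rot_inj : {in rotC t @^-1` [set v : R[i] | Hol (rotate_torus t X) j i v /\
      `|complex.Re v| < phi (Normc.normc v)] &, injective (rotC t)}.
    by move=> x y _ _; exact: rotC_inj.
  apply: sub_finite_set (finite_preimage rot_inj fin) => v [uv gv]; split.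
    exact: Hol_rotate LE zE uv.
  by rewrite normc_rotC.
have one l : (1 <= #|[set i | (l, i) \in S]%SET|)%N.
  have [i /SP iS] := exists_linked w12 phiP irr approx_diff l.
  by apply/card_gt0P; exists i.
have [r1|r1] := leqP r 1.
  have := card_pairs_rows one; apply: leq_trans; lia.
have two l : (2 <= #|[set i | (l, i) \in S]%SET|)%N.
  have [m /[dup] mS /SP mS'] := exists_linked w12 phiP irr approx_diff l.
  have [i im /SP iS] : exists2 i, i != m & infinite_set (linked w1 w2 z t phi l i).
    have [<-|lm] := eqVneq l m; last exact: linked_not_only.
    have [q ql] : exists q : 'I_r, q != l.
      have [l0|l0] := eqVneq (l : nat) 0%N.
        by exists (Ordinal r1); rewrite -val_eqE /= l0.
      by exists (Ordinal r_ge1); rewrite -val_eqE /= eq_sym.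
    exact: linked_not_only_loops ql.
  have : ([set i; m] \subset [set i | (l, i) \in S])%SET.
    by apply/fintype.subsetP => k /set2P[] ->.
  by move=> /subset_leq_card; rewrite cards2 im.
by have := card_pairs_rows two; apply: leq_trans; lia.
Qed.
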